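(* (a) The pair $(\mathrm{pk},\mathrm{des})$ is shuffle-compatible. (b) The linear map on $\mathcal{A}_{(\mathrm{pk},\mathrm{des})}$ defined by $[\pi]\mapsto\frac{t^{\mathrm{pk}(\pi)+1}(y+t)^{\mathrm{des}(\pi)-\mathrm{pk}(\pi)}(1+yt)^{|\pi|-\mathrm{pk}(\pi)-\mathrm{des}(\pi)-1}(1+y)^{2\mathrm{pk}(\pi)+1}}{(1-t)^{|\pi|+1}}x^{|\pi|}$ if $|\pi|\ge1$ and $[\pi]\mapsto1/(1-t)$ if $|\pi|=0$ is a $\mathbb{Q}$-algebra isomorphism from $\mathcal{A}_{(\mathrm{pk},\mathrm{des})}$ to the span of $\{\frac1{1-t}\}\cup\{\frac{t^{j+1}(y+t)^{k-j}(1+yt)^{n-j-k-1}(1+y)^{2j+1}}{(1-t)^{n+1}}x^n\}$ over $n\ge1$, $0\le j\le\lfloor(n-1)/2\rfloor$, $j\le k\le n-j-1$, which is a subalgebra of $\mathbb{Q}[[t*]][x,y]$. (c) $\mathcal{A}_{(\mathrm{pk},\mathrm{des})}$ is isomorphic to the span of $\{1\}\cup\{p^{n-j}(1+y)^n(1-y)^{j-2k}x^n\}_{n\ge1,\,0\le j\le n-1,\,0\le k\le\lfloor j/2\rfloor}$, a subalgebra of $\mathbb{Q}[p,x,y]$. (d) For $n\ge1$, the $n$th homogeneous component of $\mathcal{A}_{(\mathrm{pk},\mathrm{des})}$ has dimension $\lfloor(n+1)^2/4\rfloor$.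
   Context: A permutation of length $n$ is a sequence $\pi=\pi_1\cdots\pi_n$ of distinct positive integers. $\mathrm{des}(\pi)$ is the number of $i\in[n-1]$ with $\pi_i>\pi_{i+1}$; a peak is an index $2\le i\le n-1$ with $\pi_{i-1}<\pi_i>\pi_{i+1}$ and $\mathrm{pk}(\pi)$ is the number of peaks. For disjoint permutations, $S(\pi,\sigma)$ is the set of shuffles (permutations of length $|\pi|+|\sigma|$ containing both as subsequences). A statistic $\mathrm{st}$ is shuffle-compatible if for disjoint $\pi,\sigma$ the multiset $\{\mathrm{st}(\tau):\tau\in S(\pi,\sigma)\}$ depends only on $\mathrm{st}(\pi),\mathrm{st}(\sigma),|\pi|,|\sigma|$; its shuffle algebra $\mathcal{A}_{\mathrm{st}}$ has basis the classes $[\pi]$ of permutations with equal length and $\mathrm{st}$-value, product $[\pi][\sigma]=\sum_{\tau\in S(\pi,\sigma)}[\tau]$, graded by length. $\mathbb{Q}[[t*]][x,y]$ denotes polynomials in $x,y$ with coefficients formal power series in $t$, with multiplication ordinary in $x,y$ and the Hadamard product $(\sum a_nt^n)*(\sum b_nt^n)=\sum a_nb_nt^n$ in $t$. *)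

(* Defs.v *)
From HB Require Import structures.
From mathcomp Require Import all_boot all_order all_algebra generic_quotient.

From mathcomp Require Import finmap.
From mathcomp Require Import boolp classical_sets functions.
From mathcomp Require Import monalg.

Set Implicit Arguments.
Unset Strict Implicit.
Unset Printing Implicit Defensive.

Import GRing.Theory.

Local Open Scope ring_scope.

Record pword := Pword { pw_seq :> seq nat; _ : uniq pw_seq && all (leq 1) pw_seq }.

HB.instance Definition _ := [isSub for pw_seq].
HB.instance Definition _ := [Choice of pword by <:].

Lemma pw_uniq (p : pword) : uniq p.
Proof. by case: p => s /= /andP[]. Qed.

Lemma pw_pos (p : pword) : all (leq 1) p.
Proof. by case: p => s /= /andP[]. Qed.

Definition pw_nil : pword := @Pword [::] isT.

Definition disj (p q : pword) : bool := ~~ has (mem (p : seq nat)) q.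

(* Positions are counted from 0 in [seq]: the descents are the i with
   0 <= i < n-1, and the peaks the i with 1 <= i < n-1. *)
Definition des (p : pword) : nat :=
  count (fun i => nth 0 p i.+1 < nth 0 p i)%N (iota 0 (size p).-1).

Definition pk (p : pword) : nat :=
  count (fun i => (nth 0 p i.-1 < nth 0 p i) && (nth 0 p i.+1 < nth 0 p i))%N
        (iota 1 (size p).-2).

(* A duplicate-free list.  For disjoint p and q the words of length |p| + |q|
   having p and q as subsequences are rearrangements of p ++ q: see
   [mem_shuffles]. *)
Definition shuffles (p q : pword) : seq pword :=
  pmap insub [seq u <- permutations (p ++ q) | subseq p u && subseq q u].

Definition same_order (p q : pword) : Prop :=
  size p = size q /\
  forall i j, (i < size p)%N -> (j < size p)%N ->
    (nth 0 p i < nth 0 p j)%N = (nth 0 q i < nth 0 q j)%N.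

Record statistic (T : eqType) := Statistic {
  stat_fun :> pword -> T;
  _ : forall p q, same_order p q -> stat_fun p = stat_fun q }.

Definition shuffle_compatible (T : eqType) (st : statistic T) : Prop :=
  forall p q p' q' : pword, disj p q -> disj p' q' ->
    size p = size p' -> size q = size q' ->
    st p = st p' -> st q = st q' ->
    perm_eq [seq st u | u <- shuffles p q] [seq st u | u <- shuffles p' q'].

Lemma statP (T : eqType) (st : statistic T) p q :
  same_order p q -> st p = st q.
Proof. by case: st => f /= /(_ p q). Qed.

Lemma pkdes_same_order p q : same_order p q -> (pk p, des p) = (pk q, des q).
Proof.
case=> es h; rewrite /pk /des -es; congr pair; apply: eq_in_count => i /=.
  rewrite mem_iota add1n => /andP[i0 ilt].
  have i2 : (i.+1 < size p)%N by case: (size p) ilt i0 => [|[|n]] //=; case: i.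
  have i1 : (i < size p)%N by apply: ltn_trans i2.
  have im : (i.-1 < size p)%N by apply: leq_ltn_trans i1; apply: leq_pred.
  by rewrite !h.
rewrite mem_iota add0n /= => ilt.
have i2 : (i.+1 < size p)%N by case: (size p) ilt.
by rewrite h // (ltn_trans _ i2).
Qed.

Definition pkdes : statistic (nat * nat)%type :=
  Statistic (fun p q => @pkdes_same_order p q).

Lemma disjC p q : disj p q = disj q p.
Proof. by rewrite /disj has_sym. Qed.

Lemma cat_pw_uniq p q : disj p q -> uniq (p ++ q).
Proof. by move=> d; rewrite cat_uniq !pw_uniq andbT. Qed.

Lemma mem_shufflesE p q (u : pword) : (u \in shuffles p q) =
  [&& perm_eq u (p ++ q), subseq p u & subseq q u].
Proof.
rewrite /shuffles mem_pmap_sub /= mem_filter mem_permutations.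
by rewrite andbC.
Qed.

Lemma mem_shuffles p q (u : pword) : disj p q -> (u \in shuffles p q) =
  [&& size u == (size p + size q)%N, subseq p u & subseq q u].
Proof.
move=> d; rewrite mem_shufflesE; apply/idP/idP => /and3P[h pu qu]; rewrite pu qu !andbT.
  by rewrite (perm_size h) size_cat.
rewrite perm_sym; apply: uniq_perm; [exact: cat_pw_uniq | exact: pw_uniq | ].
have sub : {subset (p ++ q) <= (u : seq nat)}.
  by move=> x; rewrite mem_cat => /orP[]; apply: mem_subseq.
have := uniq_min_size (cat_pw_uniq d) sub.
by rewrite size_cat (eqP h) leqnn => /(_ isT)[].
Qed.

Lemma shuffles_uniq p q : uniq (shuffles p q).
Proof.
apply: (@pmap_sub_uniq _ _ pword); apply: filter_uniq.
exact: permutations_uniq.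
Qed.

Lemma size_shuffle p q (u : pword) : u \in shuffles p q -> size u = (size p + size q)%N.
Proof. by rewrite mem_shufflesE => /andP[/perm_size->]; rewrite size_cat. Qed.

Definition maxw (p : seq nat) : nat := \max_(i <- p) i.

Lemma shift_proof m (p : pword) :
  uniq (map (addn m) p) && all (leq 1) (map (addn m) p).
Proof.
rewrite map_inj_uniq ?pw_uniq /=; last exact: addnI.
rewrite all_map; apply/allP => x /(allP (pw_pos p)) /= x1.
exact: leq_trans x1 (leq_addl _ _).
Qed.

Definition shiftw m (p : pword) : pword := Pword (shift_proof m p).

Lemma same_order_shift m p : same_order (shiftw m p) p.
Proof.
split; rewrite /= ?size_map // => i j ip jp.
by rewrite !(nth_map 0%N) // ltn_add2l.
Qed.

Lemma disj_shift p q : disj p (shiftw (maxw p) q).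
Proof.
rewrite /disj; apply/hasPn => x /= /mapP[y yq ->].
apply/negP => h; have := @leq_bigmax_seq _ p xpredT id _ h isT.
rewrite -/(maxw p) /= -[X in (_ <= X)%N]addn0 leq_add2l.
by have := allP (pw_pos q) _ yq; case: y {h yq}.
Qed.

Section Classes.
Variables (T : eqType) (st : statistic T).

Definition st_eqv (p q : pword) : bool := (size p == size q) && (st p == st q).

Lemma st_eqv_refl : reflexive st_eqv.
Proof. by move=> p; rewrite /st_eqv !eqxx. Qed.
Lemma st_eqv_sym : symmetric st_eqv.
Proof. by move=> p q; rewrite /st_eqv eq_sym [st p == _]eq_sym. Qed.
Lemma st_eqv_trans : transitive st_eqv.
Proof. by move=> q p r /andP[/eqP a /eqP b] /andP[c d]; rewrite /st_eqv a b c d. Qed.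

Canonical st_eqv_rel := EquivRel st_eqv st_eqv_refl st_eqv_sym st_eqv_trans.

Definition st_class : Type := {eq_quot st_eqv_rel}%qT.
HB.instance Definition _ := Choice.on st_class.
HB.instance Definition _ := EqQuotient.on st_class.

Definition st_pi (p : pword) : st_class := (\pi_(st_class) p)%qT.
Definition st_repr (c : st_class) : pword := (repr c)%qT.

Lemma st_piP (p q : pword) : reflect (size p = size q /\ st p = st q) (st_pi p == st_pi q).
Proof.
have -> : (st_pi p == st_pi q) = st_eqv p q.
  by apply/eqP/idP => [/eqquotP|] //= h; apply/eqquotP.
by apply: (iffP andP) => -[/eqP a /eqP b].
Qed.

Lemma st_pi_eq p c : (st_pi p == c) =
  (size p == size (st_repr c)) && (st p == st (st_repr c)).
Proof.
rewrite -{1}[c]reprK -/(st_pi _).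
by apply/st_piP/andP => -[/eqP a /eqP b].
Qed.

Lemma st_reprK c : st_pi (st_repr c) = c.
Proof. exact: reprK. Qed.

(* The sum of [u] over all shuffles u of representatives of the two classes;
   the second representative is shifted to make it disjoint from the first.
   Independence of the representatives is [class_mulE]. *)
Definition class_mul (c d : st_class) : {malg rat[st_class]} :=
  let p := st_repr c in
  \sum_(u <- shuffles p (shiftw (maxw p) (st_repr d))) << st_pi u >>.

End Classes.

Section LinearExtension.
Variables (K : choiceType) (V : lmodType rat).
Implicit Types (F : K -> V) (a b : {malg rat[K]}).

Definition lext F a : V := \sum_(k <- msupp a) a@_k *: F k.

Lemma lextEw F (d : {fset K}) a : (msupp a `<=` d)%fset ->
  lext F a = \sum_(k <- d) a@_k *: F k.
Proof.
move=> le; rewrite /lext (big_fset_incl _ le) //= => x _ /mcoeff_outdom ->.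
by rewrite scale0r.
Qed.

Lemma lext_linear F c a b : lext F (c *: a + b) = c *: lext F a + lext F b.
Proof.
set d := (msupp a `|` msupp b)%fset.
have la : (msupp a `<=` d)%fset by apply: fsubsetUl.
have lb : (msupp b `<=` d)%fset by apply: fsubsetUr.
have lab : (msupp (c *: a + b) `<=` d)%fset.
  apply: fsubset_trans (msuppD_le _ _) _; apply: fsetUSS => //.
  exact: msuppZ_le.
rewrite (lextEw F la) (lextEw F lb) (lextEw F lab) scaler_sumr -big_split /=.
by apply: eq_bigr => k _; rewrite mcoeffD mcoeffZ scalerDl scalerA.
Qed.

HB.instance Definition _ F :=
  GRing.isLinear.Build rat {malg rat[K]} V *:%R (lext F) (lext_linear F).

Lemma lextU F k : lext F << k >> = F k.
Proof. by rewrite (lextEw F msuppU_le) big_seq_fset1 mcoeffUU scale1r. Qed.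

Lemma lext_unique (f : {linear {malg rat[K]} -> V}) F :
  (forall k, f << k >> = F k) -> f =1 lext F.
Proof.
move=> fF a; rewrite {1}[a]monalgE linear_sum; apply: eq_bigr => k _.
have -> : << a@_k *g k >> = a@_k *: << k >> :> {malg rat[K]}.
  by apply/malgP => l; rewrite mcoeffZ !mcoeffU mulrnAr mulr1.
by rewrite linearZZ fF.
Qed.

End LinearExtension.

Lemma malg_lin_ind (K : choiceType) (P : {malg rat[K]} -> Prop) :
  P 0 -> (forall c a b, P a -> P b -> P (c *: a + b)) ->
  (forall k, P << k >>) -> forall a, P a.
Proof.
move=> P0 PD PU a; rewrite [a]monalgE.
elim/big_rec: _ => // k b _ Pb.
have -> : << a@_k *g k >> = a@_k *: << k >> :> {malg rat[K]}.
  by apply/malgP => l; rewrite mcoeffZ !mcoeffU mulrnAr mulr1.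
exact: PD.
Qed.

Section BilinearExtension.
Variables (V : lmodType rat) (K : Type) (B : K -> V) (mul : V -> V -> V).
Hypothesis ind : forall P : V -> Prop, P 0 ->
  (forall c a b, P a -> P b -> P (c *: a + b)) -> (forall k, P (B k)) ->
  forall a, P a.
Hypothesis mulDl : forall c a b x, mul (c *: a + b) x = c *: mul a x + mul b x.
Hypothesis mulDr : forall c a b x, mul x (c *: a + b) = c *: mul x a + mul x b.

Lemma bilin_mul0l x : mul 0 x = 0.
Proof. by have := mulDl (-1) 0 0 x; rewrite scaler0 addr0 scaleN1r addNr. Qed.

Lemma bilin_mul0r x : mul x 0 = 0.
Proof. by have := mulDr (-1) 0 0 x; rewrite scaler0 addr0 scaleN1r addNr. Qed.

Lemma bilin_mulC : (forall k l, mul (B k) (B l) = mul (B l) (B k)) ->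
  commutative mul.
Proof.
move=> BC a b; elim/ind: a => [|c a a' IH IH'|k].
- by rewrite bilin_mul0l bilin_mul0r.
- by rewrite mulDl mulDr IH IH'.
elim/ind: b => [|c a a' IH IH'|l] //.
- by rewrite bilin_mul0l bilin_mul0r.
- by rewrite mulDl mulDr IH IH'.
Qed.

Lemma bilin_mulA :
  (forall k l m, mul (B k) (mul (B l) (B m)) = mul (mul (B k) (B l)) (B m)) ->
  associative mul.
Proof.
move=> BA a b c; elim/ind: a => [|x a a' IH IH'|k].
- by rewrite !bilin_mul0l.
- by rewrite !mulDl IH IH'.
elim/ind: b => [|x a a' IH IH'|l].
- by rewrite !(bilin_mul0l, bilin_mul0r).
- by rewrite !(mulDl, mulDr) IH IH'.
elim/ind: c => [|x a a' IH IH'|m] //.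
- by rewrite !bilin_mul0r.
- by rewrite !mulDr IH IH'.
Qed.

Lemma bilin_mul1l (e : V) : (forall k, mul e (B k) = B k) -> left_id e mul.
Proof.
move=> Be; elim/ind => [|c a b IH IH'|k] //.
- exact: bilin_mul0r.
- by rewrite mulDr IH IH'.
Qed.

End BilinearExtension.

Section ShuffleAlgebra.
Variables (T : eqType) (st : statistic T) (h : shuffle_compatible st).

Local Notation K := (st_class st).
Local Notation M := {malg rat[K]}.
Local Notation pi := (@st_pi T st).

Definition shuffle_mul (a b : M) : M :=
  lext (fun c => lext (fun d => class_mul c d) b) a.

Lemma class_mulE p q : disj p q ->
  class_mul (pi p) (pi q) = \sum_(u <- shuffles p q) << pi u >>.
Proof.
move=> dpq; rewrite /class_mul; set p' := st_repr _.
set q' := shiftw _ _.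
have [sp tp] : size p' = size p /\ st p' = st p.
  by apply/st_piP; rewrite st_reprK.
have [sq tq] : size q' = size q /\ st q' = st q.
  have [s1 t1] : size (st_repr (pi q)) = size q /\ st (st_repr (pi q)) = st q.
    by apply/st_piP; rewrite st_reprK.
  rewrite -s1 -t1; have so := same_order_shift (maxw p') (st_repr (pi q)).
  by split; [case: so | exact: statP].
have dpq' : disj p' q' by apply: disj_shift.
have /permP pe := h dpq' dpq sp sq tp tq.
have sumE a b : \sum_(u <- shuffles a b) << pi u >> =
    \sum_(k <- map pi (shuffles a b)) (<< k >> : M) by rewrite big_map.
rewrite !sumE; apply: perm_big.
apply/allP => c _; apply/eqP; rewrite !count_map.
have cE (a b : pword) : size a = size p -> size b = size q ->
  count (preim pi (pred1 c)) (shuffles a b) =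
  if (size p + size q == size (st_repr c))%N
  then count (pred1 (st (st_repr c))) [seq st u | u <- shuffles a b] else 0%N.
  move=> sa sb; rewrite count_map; case: ifP => e.
    apply: eq_in_count => u /size_shuffle su.
    by rewrite [LHS]/= st_pi_eq su sa sb e.
  rewrite -(count_pred0 (shuffles a b)); apply: eq_in_count => u /size_shuffle su.
  by rewrite [LHS]/= st_pi_eq su sa sb e.
by rewrite !cE // pe.
Qed.

Lemma shuffle_mulDl c a b x :
  shuffle_mul (c *: a + b) x = c *: shuffle_mul a x + shuffle_mul b x.
Proof. exact: lext_linear. Qed.

Lemma shuffle_mulDr c a b x :
  shuffle_mul x (c *: a + b) = c *: shuffle_mul x a + shuffle_mul x b.
Proof.
rewrite /shuffle_mul /lext scaler_sumr -big_split /=; apply: eq_bigr => k _.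
by rewrite -/(lext _ _) lext_linear scalerDr !scalerA mulrC.
Qed.

Lemma shuffle_mulUU p q : disj p q ->
  shuffle_mul << pi p >> << pi q >> = \sum_(u <- shuffles p q) << pi u >>.
Proof. by move=> d; rewrite /shuffle_mul !lextU class_mulE. Qed.

Lemma shuffle_mul_suml (I : Type) (s : seq I) (F : I -> M) x :
  shuffle_mul (\sum_(i <- s) F i) x = \sum_(i <- s) shuffle_mul (F i) x.
Proof. by rewrite /shuffle_mul linear_sum. Qed.

#[local] Opaque shuffle_mul.

Lemma pi_shift m p : pi (shiftw m p) = pi p.
Proof.
apply/eqP/st_piP; have so := same_order_shift m p.
by split; [case: so | exact: statP].
Qed.

Lemma shuffle_mulC : commutative shuffle_mul.
Proof.
apply: (bilin_mulC (@malg_lin_ind K) shuffle_mulDl shuffle_mulDr) => k l.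
rewrite -[k]st_reprK -[l]st_reprK -(pi_shift (maxw (st_repr k)) (st_repr l)).
have d := disj_shift (st_repr k) (st_repr l).
rewrite !shuffle_mulUU //; last by rewrite disjC.
apply: perm_big; apply: uniq_perm; rewrite ?shuffles_uniq // => u.
rewrite !mem_shufflesE [subseq _ _ && _]andbC.
by rewrite perm_sym perm_catC perm_sym.
Qed.

Definition shuffles3 (p q r : pword) : seq pword :=
  pmap insub [seq u <- permutations (p ++ q ++ r) |
                [&& subseq p u, subseq q u & subseq r u]].

Lemma mem_shuffles3 p q r (u : pword) : (u \in shuffles3 p q r) =
  [&& perm_eq u (p ++ q ++ r), subseq p u, subseq q u & subseq r u].
Proof.
by rewrite /shuffles3 mem_pmap_sub /= mem_filter mem_permutations andbC.
Qed.

Lemma shuffles3_uniq p q r : uniq (shuffles3 p q r).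
Proof.
apply: (@pmap_sub_uniq _ _ pword); apply: filter_uniq.
exact: permutations_uniq.
Qed.

Lemma shuffle3E (F : pword -> M) p q r : disj p q -> disj p r -> disj q r ->
  \sum_(u <- shuffles p q) \sum_(v <- shuffles u r) F v =
  \sum_(v <- shuffles3 p q r) F v.
Proof.
move=> dpq dpr dqr.
have inner (u : pword) : u \in shuffles p q ->
  \sum_(v <- shuffles u r) F v =
  \sum_(v <- shuffles3 p q r | v \in shuffles u r) F v.
  rewrite mem_shufflesE => /and3P[eu pu qu]; rewrite -[RHS]big_filter.
  apply: perm_big; apply: uniq_perm; rewrite ?shuffles_uniq //.
    by rewrite filter_uniq // shuffles3_uniq.
  move=> v; rewrite mem_filter; case vu: (v \in _) => //=.
  move: vu; rewrite mem_shufflesE mem_shuffles3 => /and3P[ev uv rv]; apply/esym.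
  rewrite (subseq_trans pu uv) (subseq_trans qu uv) rv !andbT.
  by apply: perm_trans ev _; rewrite catA perm_cat2r.
rewrite big_seq (eq_bigr _ inner) -big_seq (exchange_big_dep xpredT) //=.
rewrite big_seq [RHS]big_seq; apply: eq_bigr => v.
rewrite mem_shuffles3 => /and4P[ev pv qv rv].
have u0P : uniq (filter (mem (p ++ q)) v) && all (leq 1) (filter (mem (p ++ q)) v).
  rewrite filter_uniq ?pw_uniq //=; apply/allP => x.
  by rewrite mem_filter => /andP[_]; apply: (allP (pw_pos v)).
pose u0 := Pword u0P.
have memv x : x \in (v : seq nat) = (x \in p ++ q ++ r) by exact: perm_mem.
have sub0 (s : pword) : subseq s v -> {subset (s : seq nat) <= p ++ q} ->
    subseq s u0.
  move=> /(subseq_uniqP (pw_uniq v)) sE ss.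
  have -> : (s : seq nat) = filter (mem (s : seq nat)) u0.
    rewrite {1}sE /= -filter_predI; apply: eq_filter => x /=.
    by case sx: (x \in (s : seq nat)) => //=; rewrite ss.
  exact: filter_subseq.
have e0 : perm_eq u0 (p ++ q).
  apply: uniq_perm; rewrite ?pw_uniq ?cat_pw_uniq // => x.
  rewrite /= mem_filter memv /= catA [x \in (_ ++ r)]mem_cat.
  by case: (x \in _).
have u0in : u0 \in shuffles p q.
  rewrite mem_shufflesE e0 !sub0 // => x xs; rewrite mem_cat xs ?orbT //.
have vin (u : pword) : u \in shuffles p q -> (v \in shuffles u r) = (u == u0).
  rewrite mem_shufflesE => /and3P[eu pu qu].
  rewrite mem_shufflesE rv andbT; apply/andP/eqP => [[_ uv]|->].
    apply: val_inj => /=; rewrite (subseq_uniqP (pw_uniq v) uv).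
    by apply: eq_filter => x /=; rewrite (perm_mem eu).
  split; last exact: filter_subseq.
  by apply: perm_trans ev _; rewrite catA perm_cat2r perm_sym.
rewrite big_mkcond (bigD1_seq u0) ?shuffles_uniq //= vin // eqxx.
rewrite big_seq_cond big1 ?addr0 // => u /andP[us une].
by rewrite vin // (negbTE une).
Qed.

Lemma disj_reprs (k l m : K) : exists p q r, [/\ disj p q, disj p r, disj q r,
  k = pi p & l = pi q /\ m = pi r].
Proof.
pose p := st_repr k; pose q := shiftw (maxw p) (st_repr l).
pose N := maxn (maxw p) (maxw q); pose r := shiftw N (st_repr m).
exists p, q, r; rewrite !pi_shift !st_reprK.
have dN (s : pword) : (maxw s <= N)%N -> disj s r.
  move=> sN; rewrite /disj; apply/hasPn => x /= /mapP[y yq ->].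
  apply/negP => hx; have := @leq_bigmax_seq _ s xpredT id _ hx isT.
  rewrite -/(maxw s) /= => le; have := leq_trans le sN.
  rewrite -[X in (_ <= X)%N]addn0 leq_add2l.
  by have := allP (pw_pos (st_repr m)) _ yq; case: y {hx yq le}.
split=> //; first exact: disj_shift.
  by apply: dN; exact: leq_maxl.
by apply: dN; exact: leq_maxr.
Qed.

Lemma shuffle_mulA : associative shuffle_mul.
Proof.
have assoc3 p q r : disj p q -> disj p r -> disj q r ->
  shuffle_mul (shuffle_mul << pi p >> << pi q >>) << pi r >> =
  \sum_(v <- shuffles3 p q r) << pi v >>.
  move=> dpq dpr dqr; rewrite -shuffle3E // shuffle_mulUU //.
  rewrite shuffle_mul_suml /= big_seq [RHS]big_seq.
  apply: eq_bigr => u; rewrite mem_shufflesE => /and3P[eu _ _].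
  rewrite shuffle_mulUU //.
  apply/hasPn => x xr; rewrite /= (perm_mem eu) mem_cat negb_or.
  by rewrite (hasPn dpr) ?(hasPn dqr).
apply: (bilin_mulA (@malg_lin_ind K) shuffle_mulDl shuffle_mulDr) => k l m.
have [p [q [r [dpq dpr dqr -> []]]]] := disj_reprs k l m.
have dqp : disj q p by rewrite disjC.
have drp : disj r p by rewrite disjC.
move=> -> ->; apply: etrans (shuffle_mulC _ _) _.
apply: etrans (assoc3 _ _ _ dqr dqp drp) _.
apply: etrans _ (esym (assoc3 _ _ _ dpq dpr dqr)).
apply: perm_big; apply: uniq_perm; rewrite ?shuffles3_uniq // => v.
rewrite !mem_shuffles3; congr andb; last first.
  by rewrite andbA andbC.
by rewrite ![perm_eq v _]perm_sym [q ++ r ++ p]catA perm_catC.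
Qed.

Lemma shuffle_mul1l : left_id (<< pi pw_nil >> : M) shuffle_mul.
Proof.
apply: (bilin_mul1l (@malg_lin_ind K) shuffle_mulDr) => k.
rewrite -[k]st_reprK shuffle_mulUU; last by rewrite disjC.
set p := st_repr k.
have -> : \sum_(u <- shuffles pw_nil p) << pi u >> =
          \sum_(u <- [:: p]) (<< pi u >> : M).
  apply: perm_big; apply: uniq_perm; rewrite ?shuffles_uniq // => u.
  rewrite mem_shuffles ?inE; last by rewrite disjC.
  rewrite sub0seq /= add0n; apply/andP/eqP => [[/eqP su pu]|->]; last first.
    by rewrite eqxx subseq_refl.
  by apply: val_inj => /=; apply/esym/eqP; rewrite -(size_subseq_leqif pu) su.
by rewrite big_seq1.
Qed.

End ShuffleAlgebra.

(* [h] makes the product below associative; the carrier does not depend on it. *)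
Definition shuffle_alg (T : eqType) (st : statistic T)
  (h : shuffle_compatible st) : Type := {malg rat[st_class st]}.

Section ShuffleAlgebraStructure.
Variables (T : eqType) (st : statistic T) (h : shuffle_compatible st).

HB.instance Definition _ := GRing.Lmodule.on (shuffle_alg h).

Definition cls (p : pword) : shuffle_alg h := << st_pi st p >>.

Fact shuffle_alg_mulDl : left_distributive (@shuffle_mul T st) +%R.
Proof.
by move=> a b x; have := shuffle_mulDl 1 a b x; rewrite !scale1r.
Qed.

Fact shuffle_alg_one_neq0 : cls pw_nil != 0.
Proof.
by apply/eqP => /malgP/(_ (st_pi st pw_nil)); rewrite mcoeffUU mcoeff0.
Qed.

HB.instance Definition _ := GRing.Zmodule_isComNzRing.Build (shuffle_alg h)
  (shuffle_mulA h) (shuffle_mulC h) (shuffle_mul1l h) shuffle_alg_mulDl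
  shuffle_alg_one_neq0.

Fact shuffle_alg_scaleAl c (a b : shuffle_alg h) : c *: (a * b) = (c *: a) * b.
Proof.
rewrite -[c *: a]addr0; apply: etrans (esym (shuffle_mulDl c a 0 b)).
by rewrite -[LHS]addr0; congr (_ + _); exact: esym (mul0r (b : shuffle_alg h)).
Qed.

HB.instance Definition _ :=
  GRing.Lmodule_isLalgebra.Build rat (shuffle_alg h) shuffle_alg_scaleAl.
HB.instance Definition _ :=
  GRing.Lalgebra_isComAlgebra.Build rat (shuffle_alg h).

Lemma cls_mul p q : disj p q -> cls p * cls q = \sum_(u <- shuffles p q) cls u.
Proof. exact: shuffle_mulUU. Qed.

Lemma cls_linear_eq (V : lmodType rat) (f g : {linear shuffle_alg h -> V}) :
  (forall p, f (cls p) = g (cls p)) -> f =1 g.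
Proof.
move=> fg; elim/malg_lin_ind => [|c a b fa fb|k].
- by rewrite !linear0.
- by rewrite !linearP fa fb.
by rewrite -[k]st_reprK; exact: fg.
Qed.

Lemma cls_eqP (p q : pword) :
  cls p = cls q <-> size p = size q /\ st p = st q.
Proof.
split => [e|e]; last by rewrite /cls (eqP (introT (st_piP st p q) e)).
apply/(st_piP st); have /malgP/(_ (st_pi st p)) := e.
by rewrite mcoeffUU mcoeffU; case: eqP => // ->.
Qed.

End ShuffleAlgebraStructure.

Definition fps : Type := nat -> rat.
HB.instance Definition _ := GRing.Zmodule.on fps.

Section FormalPowerSeries.
Implicit Types f g : fps.

Definition fps_one : fps := fun m => (m == 0%N)%:R.

Definition fps_mul f g : fps := fun m => \sum_(i < m.+1) f i * g (m - i)%N.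

Definition fps_trunc m f : {poly rat} := \poly_(i < m.+1) f i.

Lemma fps_mul_trunc m f g k : (k <= m)%N ->
  fps_mul f g k = (fps_trunc m f * fps_trunc m g)`_k.
Proof.
move=> km; rewrite coefM /fps_mul; apply: eq_bigr => i _.
have im : (i < m.+1)%N by apply: leq_trans (ltn_ord i) _.
by rewrite !coef_poly im ltnS (leq_trans (leq_subr _ _) km).
Qed.

Lemma fps_mulC : commutative fps_mul.
Proof. by move=> f g; apply/funext => m; rewrite !(fps_mul_trunc _ _ (leqnn m)) mulrC. Qed.

Lemma fps_mulA : associative fps_mul.
Proof.
move=> f g k; apply/funext => m.
have tl a b : (fps_trunc m (fps_mul a b) * fps_trunc m k)`_m =
              (fps_trunc m a * fps_trunc m b * fps_trunc m k)`_m.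
  rewrite !coefM; apply: eq_bigr => i _.
  rewrite [(fps_trunc m (fps_mul a b))`_ _]coef_poly ltn_ord.
  by rewrite (fps_mul_trunc _ _ (ltn_ord i : (i <= m)%N)).
have tr a b : (fps_trunc m f * fps_trunc m (fps_mul a b))`_m =
              (fps_trunc m f * (fps_trunc m a * fps_trunc m b))`_m.
  rewrite !coefM; apply: eq_bigr => i _.
  rewrite [(fps_trunc m (fps_mul a b))`_ _]coef_poly ltnS leq_subr.
  by rewrite (fps_mul_trunc _ _ (leq_subr i m)).
by rewrite !(fps_mul_trunc _ _ (leqnn m)) tl tr mulrA.
Qed.

Lemma fps_mul1 : left_id fps_one fps_mul.
Proof.
move=> f; apply/funext => m; rewrite /fps_mul big_ord_recl /= mul1r subn0.
by rewrite big1 ?addr0 // => i _; rewrite /fps_one /= mul0r.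
Qed.

Lemma fps_mulDl : left_distributive fps_mul +%R.
Proof.
move=> f g k; apply/funext => m.
have -> : (fps_mul f k + fps_mul g k) m = fps_mul f k m + fps_mul g k m by [].
rewrite /fps_mul -big_split /=.
by apply: eq_bigr => i _; rewrite mulrDl.
Qed.

Lemma fps_one_neq0 : fps_one != 0.
Proof. by apply/eqP => /(congr1 (fun f : fps => f 0%N)). Qed.

End FormalPowerSeries.

HB.instance Definition _ :=
  GRing.Zmodule_isComNzRing.Build fps fps_mulA fps_mulC fps_mul1 fps_mulDl
    fps_one_neq0.

(* Units are the series with a multiplicative inverse, so that [f^-1] is the
   inverse whenever there is one. *)
Definition fps_unit : pred fps := fun f => `[< exists g : fps, g * f = 1 >].

Definition fps_inv (f : fps) : fps :=
  if pselect (exists g : fps, g * f = 1) is left e then projT1 (cid e) else f.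

Fact fps_mulVf : {in fps_unit, left_inverse 1 fps_inv *%R}.
Proof.
move=> f /asboolP e; rewrite /fps_inv; case: pselect => // e'.
by case: cid.
Qed.

Fact fps_unitP (f g : fps) : g * f = 1 -> fps_unit f.
Proof. by move=> e; apply/asboolP; exists g. Qed.

Fact fps_inv_out : {in [predC fps_unit], fps_inv =1 id}.
Proof.
move=> f /negP nu; rewrite /fps_inv; case: pselect => // e.
by case: nu; apply/asboolP.
Qed.

HB.instance Definition _ :=
  GRing.ComNzRing_hasMulInverse.Build fps fps_mulVf fps_unitP fps_inv_out.

Definition fps_t : fps := fun m => (m == 1%N)%:R.

Lemma fps_mulE (f g : fps) m : (f * g) m = \sum_(i < m.+1) f i * g (m - i)%N.
Proof. by []. Qed.

Definition fps_geom : fps := fun=> 1.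

Lemma fps_geomE : (1 - fps_t)^-1 = fps_geom.
Proof.
have e : fps_geom * (1 - fps_t) = 1.
  rewrite mulrC; apply/funext => m; rewrite fps_mulE /fps_geom.
  have E i : (1 - fps_t : fps) i = (i == 0%N)%:R - (i == 1%N)%:R by [].
  have E1 i : (1 : fps) i = (i == 0%N)%:R by [].
  rewrite E1 big_ord_recl E mulr1 subr0; case: m => [|m].
    by rewrite big_ord0 addr0.
  rewrite big_ord_recl E mulr1 sub0r big1 ?addr0 ?subrr //.
have u : 1 - fps_t \is a GRing.unit by apply/asboolP; exists fps_geom.
by apply: (mulIr u); rewrite mulVr // e.
Qed.

(* Pointwise ring structure of the function space: its product is the Hadamard
   product, with unit the constant sequence 1/(1 - t). *)
Definition hfps : Type := nat -> rat.
HB.instance Definition _ := GRing.ComNzRing.on hfps.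

Lemma hfps_mulE (f g : hfps) m : (f * g) m = f m * g m.
Proof. by []. Qed.

Definition to_hfps (f : fps) : hfps := f.

HB.instance Definition _ := GRing.isZmodMorphism.Build fps hfps to_hfps
  (fun f g => erefl).

Lemma to_hfps_geom : to_hfps (1 - fps_t)^-1 = 1.
Proof. by rewrite fps_geomE. Qed.

(* Q[[t*]][x,y] as polynomials in x over polynomials in y.  The inner variable
   is y. *)
Definition Qtxy : Type := {poly {poly hfps}}.
HB.instance Definition _ := GRing.ComNzRing.on Qtxy.

(* A rational number c acts as the constant series c/(1 - t) of Q[[t*]], i.e.
   multiplies every coefficient by c: see [Qtxy_scaleE]. *)
Definition Qconst (c : rat) : Qtxy := ((fun=> c) : hfps)%:P%:P.
Definition Qscale (c : rat) (f : Qtxy) : Qtxy := Qconst c * f.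

Fact QconstM c d : Qconst (c * d) = Qconst c * Qconst d.
Proof. by rewrite /Qconst -!polyCM. Qed.
Fact QconstD c d : Qconst (c + d) = Qconst c + Qconst d.
Proof. by rewrite /Qconst -!polyCD. Qed.
Fact Qconst1 : Qconst 1 = 1.
Proof. by []. Qed.

Fact QscaleA c d f : Qscale c (Qscale d f) = Qscale (c * d) f.
Proof. by rewrite /Qscale mulrA QconstM. Qed.
Fact Qscale1 : left_id 1 Qscale.
Proof. by move=> f; rewrite /Qscale Qconst1 mul1r. Qed.
Fact QscaleDr : right_distributive Qscale +%R.
Proof. by move=> c f g; rewrite /Qscale mulrDr. Qed.
Fact QscaleDl f : {morph Qscale^~ f : c d / c + d}.
Proof. by move=> c d; rewrite /Qscale QconstD mulrDl. Qed.

HB.instance Definition _ := GRing.Zmodule_isLmodule.Build rat Qtxy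
  QscaleA Qscale1 QscaleDr QscaleDl.

Fact QscaleAl (c : rat) (f g : Qtxy) : c *: (f * g) = (c *: f) * g.
Proof. exact: mulrA. Qed.

HB.instance Definition _ := GRing.Lmodule_isLalgebra.Build rat Qtxy QscaleAl.
HB.instance Definition _ := GRing.Lalgebra_isComAlgebra.Build rat Qtxy.

Lemma Qtxy_scaleE (c : rat) (f : Qtxy) i j m :
  ((c *: f)`_i`_j : hfps) m = c * (f`_i`_j : hfps) m.
Proof. by rewrite [c *: f]/(Qconst c * f) /Qconst !coefCM. Qed.

Local Open Scope classical_set_scope.

Definition Qspan (V : lmodType rat) (B : set V) : set V :=
  [set v | exists n (c : 'I_n -> rat) (b : 'I_n -> V),
     (forall i, B (b i)) /\ v = \sum_(i < n) c i *: b i].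

Definition has_dim (V : lmodType rat) (S : set V) (d : nat) : Prop :=
  exists b : 'I_d -> V,
    (forall c : 'I_d -> rat, \sum_(i < d) c i *: b i = 0 -> forall i, c i = 0) /\
    Qspan (range b) = S.

Definition subalgebra (A : algType rat) (S : set A) : Prop :=
  GRing.subalg_closed (mem S).

Definition homogeneous (T : eqType) (st : statistic T)
    (h : shuffle_compatible st) (n : nat) : set (shuffle_alg h) :=
  Qspan [set cls h p | p in [set p : pword | size p = n]].
Arguments homogeneous {T st} h n.

(* Q[[t]][y] and Q[[t*]][y] have the same elements; only the products differ. *)
Definition hpoly (f : {poly fps}) : Qtxy := (map_poly to_hfps f)%:P.

(* Arithmetic in Q[[t]][y], with the ordinary product of series; 'X is y.  The
   exponents are truncated differences, which are exact for the (n, j, k) =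
   (|p|, pk p, des p) of a nonempty p, as j <= k <= n - j - 1. *)
Definition pd_frac (n j k : nat) : {poly fps} :=
  fps_t%:P ^+ j.+1 * ('X + fps_t%:P) ^+ (k - j)
    * (1 + 'X * fps_t%:P) ^+ (n - j - k - 1) * (1 + 'X) ^+ (2 * j + 1)
    * ((1 - fps_t) ^- n.+1)%:P.

Lemma hpolyE (f : {poly fps}) i : (hpoly f)`_0`_i = to_hfps f`_i.
Proof. by rewrite /hpoly coefC eqxx coef_map. Qed.

Definition pd_term (n j k : nat) : Qtxy := hpoly (pd_frac n j k) * 'X^n.

Definition pd_unit : Qtxy := hpoly ((1 - fps_t)^-1)%:P.

Definition pd_image (p : pword) : Qtxy :=
  if size p == 0%N then pd_unit else pd_term (size p) (pk p) (des p).

Definition pd_span : set Qtxy :=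
  Qspan ([set pd_unit] `|`
    [set f | exists n j k : nat,
       [/\ (1 <= n)%N, (j <= n.-1./2)%N, (j <= k <= n - j - 1)%N
         & f = pd_term n j k]]).

From mathcomp Require Import mpoly.

(* [mpoly n R] is written out because monalg and mpoly give the notation
   {mpoly R[n]} two different meanings. *)
Definition Qpxy : comAlgType rat := mpoly 3 rat.
Definition var_p : Qpxy := 'X_(@Ordinal 3 0 isT).
Definition var_x : Qpxy := 'X_(@Ordinal 3 1 isT).
Definition var_y : Qpxy := 'X_(@Ordinal 3 2 isT).

Definition pol_span : set Qpxy :=
  Qspan ([set 1] `|`
    [set f | exists n j k : nat,
       [/\ (1 <= n)%N, (j <= n - 1)%N, (k <= j./2)%N
         & f = var_p ^+ (n - j) * (1 + var_y) ^+ n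
                 * (1 - var_y) ^+ (j - 2 * k) * var_x ^+ n]]).

(* Main.v *)
Require Import Defs.
From HB Require Import structures.
From mathcomp Require Import all_boot all_order all_algebra.
From mathcomp Require Import boolp classical_sets functions.
From mathcomp Require Import finmap monalg.
From mathcomp Require Import ring zify.
From mathcomp Require mpoly.

(** For a word [w], [wcount m w] counts, with weight [al] per barred and [be] per
    unbarred letter, the maps from [w] to 1' < 1 < 2' < 2 < ... < m' < m that
    weakly increase along [w], with barred fibres decreasing and unbarred
    fibres increasing.  Concatenating sorted runs preserves multiplicativity
    under shuffles, so [wcount m] is multiplicative; a transfer recursion on
    the first letter shows that its generating function in m is
    [run_frac (pk w) c d] with c = des - pk and d = n - pk - des - 1, which
    for al = y, be = 1 is the image of [w] in the theorem.  The coefficients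
    at t^(pk+1) are triangular in (pk, des), whence linear independence and
    shuffle-compatibility.

    For part (c) take al = u, be = 1 - u.  With z = 1 - 2u and
    s = (1+t)/(1-t), the generating function becomes
    t/(1-t)^2 (s^2-1)^pk (s-z)^c (s+z)^d / 2^(n-1), and t s^b/(1-t)^2 is the
    generating function of a polynomial in m of degree b+1 and parity b+1.
    Hence [wcount m w] is the value at p = m of a combination of monomials
    p^a z^i with a >= 1 and n - a - i even and nonnegative; there are as many
    of these as classes of size n, so injectivity gives surjectivity. *)

Set Implicit Arguments.
Unset Strict Implicit.
Unset Printing Implicit Defensive.

Import GRing.Theory.

Local Open Scope classical_set_scope.
Local Open Scope ring_scope.

(** * Shuffles of words *)

(** Recursion on first letters supports the inductions below, which the filtered list of
    permutations in [shuffles] does not. The inner fixpoint is there because either argument may be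
    the one that shrinks. *)
Fixpoint sh (u : seq nat) {struct u} : seq nat -> seq (seq nat) :=
  fix sh_u (v : seq nat) {struct v} :=
    match u, v with
    | [::], _ => [:: v]
    | _, [::] => [:: u]
    | a :: u', b :: v' => map (cons a) (sh u' v) ++ map (cons b) (sh_u v')
    end.

Lemma sh0s v : sh [::] v = [:: v].
Proof. by case: v. Qed.

Lemma shs0 u : sh u [::] = [:: u].
Proof. by case: u. Qed.

Lemma sh_cons a u b v :
  sh (a :: u) (b :: v) = map (cons a) (sh u (b :: v)) ++ map (cons b) (sh (a :: u) v).
Proof. by []. Qed.

Arguments sh : simpl never.

Lemma sh_sym u v : perm_eq (sh u v) (sh v u).
Proof.
elim: u v => [|a u IHu] v; first by rewrite sh0s shs0.
elim: v => [|b v IHv] //.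
rewrite !sh_cons perm_catC; apply: perm_cat; apply: perm_map => //.
Qed.

Lemma uniq_cat_heads (a b : nat) u v : uniq ((a :: u) ++ b :: v) -> a != b.
Proof. by apply: contraTneq => ->; rewrite /= mem_cat inE eqxx orbT. Qed.

Lemma mem_sh u v w : uniq (u ++ v) ->
  (w \in sh u v) = [&& perm_eq w (u ++ v), subseq u w & subseq v w].
Proof.
have base t s : (s \in [:: t]) = perm_eq s t && subseq t s.
  rewrite inE; apply/eqP/andP => [->|[ps ts]]; first by rewrite perm_refl subseq_refl.
  by apply/esym/eqP; rewrite -(size_subseq_leqif ts) (perm_size ps).
have consE (c : nat) s (L : seq (seq nat)) : (s \in map (cons c) L) =
    if s is d :: s' then (d == c) && (s' \in L) else false.
  case: s => [|d s]; first by apply/negP => /mapP[].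
  apply/mapP/andP => [[x xL [-> ->]]|[/eqP-> sL]]; first by rewrite eqxx.
  by exists s.
elim: u v w => [|a u IHu] v w; first by rewrite sh0s base sub0seq.
elim: v w => [|b v IHv] w U; first by rewrite shs0 base cats0 sub0seq andbT.
have neq : a != b := uniq_cat_heads U.
have Uu : uniq (u ++ b :: v) by case/andP: U.
have Uv : uniq ((a :: u) ++ v).
  by apply: subseq_uniq U; apply: cat_subseq => //; apply: subseq_cons.
rewrite sh_cons mem_cat !consE; case: w => [|x w].
  by rewrite perm_sym; apply/esym/negP => /andP[/perm_nilP].
rewrite IHu // IHv //= ![a == x]eq_sym ![b == x]eq_sym.
have [->|xa] := eqVneq x a.
  by rewrite (negbTE neq) /= orbF perm_cons.
have [->|xb] /= := eqVneq x b.
  have /permPr -> : perm_eq (a :: u ++ b :: v) (b :: a :: u ++ v).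
    by apply/permPl; exact: perm_catCA (a :: u) [:: b] v.
  by rewrite perm_cons.
(* The head x is neither a nor b, so both words are subsequences of the tail [w], which has one
   letter too few to contain them. *)
apply/esym/negP => /and3P[pw uw vw].
have sub : {subset (a :: u) ++ b :: v <= w}.
  by move=> y; rewrite mem_cat => /orP[]; apply: mem_subseq.
have := uniq_leq_size U sub; have /= := perm_size pw; rewrite size_cat => -[->].
by rewrite ltnn.
Qed.

Lemma sh_uniq u v : uniq (u ++ v) -> uniq (sh u v).
Proof.
elim: u v => [|a u IHu] v; first by rewrite sh0s.
elim: v => [|b v IHv] // U.
have Uu : uniq (u ++ b :: v) by case/andP: U.
have Uv : uniq ((a :: u) ++ v).
  by apply: subseq_uniq U; apply: cat_subseq => //; apply: subseq_cons.
rewrite sh_cons cat_uniq !map_inj_uniq ?IHu ?IHv //=; try by move=> ? ? [].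
rewrite andbT; apply/hasPn => x /mapP[y _ ->]; apply/negP => /mapP[z _ [e _]].
by move: U; rewrite e /= mem_cat inE eqxx orbT.
Qed.

Lemma shuffles_sh (p q : pword) : disj p q ->
  perm_eq (map val (shuffles p q)) (sh p q).
Proof.
move=> d; have U := cat_pw_uniq d; apply: uniq_perm; rewrite ?sh_uniq //.
  by rewrite map_inj_uniq ?shuffles_uniq //; exact: val_inj.
move=> w; rewrite mem_sh //; apply/mapP/and3P => [[u + ->]|[pw sp sq]].
  by rewrite mem_shufflesE => /and3P.
have h : uniq w && all (leq 1) w.
  by rewrite (perm_uniq pw) U (perm_all _ pw) all_cat !pw_pos.
by exists (Pword h) => //; rewrite mem_shufflesE; apply/and3P.
Qed.

(** * Multiplicative functions built from sorted runs *)

Section Lead.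
Variables (R : comNzRingType) (r : rel nat) (c : R).
Implicit Types (G : seq nat -> R) (u v w : seq nat).

(* The weight of the decompositions [w = w1 w2] with [w1] nonempty and sorted by
   [r]: each letter of [w1] weighs [c], and [w2] weighs [G w2]. *)
Fixpoint lead G w : R :=
  if w is _ :: w' then
    c * (G w' + (if w' is b :: _ then if r (head 0 w) b then lead G w' else 0 else 0))
  else 0.

Definition chi G w : R := G w + lead G w.

(** These are the characters of the shuffle algebra, restricted to pairs of words without a repeated
    letter; [chi] is the convolution of G with the indicator of sorted words weighted by powers of
    c. *)
Definition multiplicative G : Prop :=
  forall u v, uniq (u ++ v) -> \sum_(w <- sh u v) G w = G u * G v.

Hypothesis r_trans : transitive r.
Hypothesis r_total : forall a b, a != b -> r b a = ~~ r a b.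

Lemma lead_cons2 G a b w :
  lead G (a :: b :: w) = c * (G (b :: w) + (if r a b then lead G (b :: w) else 0)).
Proof. by []. Qed.

Lemma sum_lead_cons2 G a b (s : seq (seq nat)) :
  \sum_(w <- s) lead G (a :: b :: w) =
  c * (\sum_(w <- s) G (b :: w) + (if r a b then \sum_(w <- s) lead G (b :: w) else 0)).
Proof.
rewrite (eq_bigr _ (fun w _ => lead_cons2 G a b w)) -mulr_sumr big_split /=.
by case: ifP => // _; rewrite [X in _ + X]big1.
Qed.

(* A shuffle starting with [a] puts [b] inside the sorted run of [a] or after it,
   and only the former needs [r a b]; which one happens is decided by [r a b]
   alone, as [r] is total. *)
Lemma sum_lead_sh G a u b v : G [::] = 1 -> multiplicative G ->
    uniq ((a :: u) ++ b :: v) ->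
  \sum_(w <- sh u (b :: v)) lead G (a :: w) =
  lead G (a :: u) * (if r a b then chi G (b :: v) else G (b :: v)).
Proof.
move=> G1 Gm; have [n] := ubnP (size u + size v)%N.
elim: n a u b v => // n IH a [|a' u] b v sz U.
  rewrite sh0s big_seq1 lead_cons2 /lead G1 addr0 mulr1 /chi.
  by case: ifP => _; rewrite ?addr0.
have U1 : uniq ((a' :: u) ++ b :: v) by case/andP: U.
have U2 : uniq ((b :: v) ++ a' :: u) by rewrite uniq_catC.
have := Gm _ _ U1; rewrite sh_cons !big_cat !big_map /= !sum_lead_cons2.
set g1 := \sum_(_ <- _) _; set g2 := \sum_(_ <- _) _ => GE.
(* Multiplicativity gives only the sum of [g1] and [g2]; once [g1] is eliminated, [g2] cancels
   between the shuffles continuing with a' and those continuing with b. *)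
have -> : g1 = G (a' :: u) * G (b :: v) - g2 by rewrite -GE addrK.
have sz' : (size u + size v < n)%N by [].
rewrite IH //.
rewrite (perm_big _ (sh_sym (a' :: u) v)) IH // 1?addnC //.
have aa' : a != a' by move: U; rewrite /= inE; case: eqP.
have ab : a != b := uniq_cat_heads U.
have a'b : a' != b := uniq_cat_heads U1.
(* The three instances of transitivity exclude the inconsistent orderings of a, a' and b; in every
   other ordering the identity is polynomial. *)
have tr x y z : r x y -> r y z -> r x z by move/r_trans; apply.
have := @tr a a' b; have := @tr a' a b; have := @tr a b a'.
rewrite (r_total aa') (r_total a'b) /chi.
by case: (r a a'); case: (r a b); case: (r a' b) => //= t1 t2 t3;
  try (by have := t1 isT isT); try (by have := t2 isT isT); try (by have := t3 isT isT); ring.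
Qed.

Lemma chi_nil G : chi G [::] = G [::].
Proof. by rewrite /chi addr0. Qed.

(** Shuffles starting with a give [lead] of the first word times [chi] or G of the second, and
    symmetrically for b. Exactly one of [r a b] and [r b a] holds, so the product of the two [lead]
    terms occurs exactly once, as in the expansion of the product of the two [chi]. *)
Lemma chi_multiplicative G :
  G [::] = 1 -> multiplicative G -> multiplicative (chi G).
Proof.
move=> G1 Gm [|a u] [|b v] U; rewrite ?(sh0s, shs0) ?big_seq1 ?chi_nil ?G1 ?(mul1r, mulr1) //.
have U2 : uniq ((b :: v) ++ a :: u) by rewrite uniq_catC.
rewrite /chi big_split /= Gm // sh_cons big_cat !big_map /=.
rewrite sum_lead_sh // (perm_big _ (sh_sym (a :: u) v)) sum_lead_sh //.
have ab : a != b := uniq_cat_heads U.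
by rewrite (r_total ab) /chi; case: (r a b) => /=; ring.
Qed.

End Lead.

Section RunCount.
Variables (R : comNzRingType) (al be : R).

Definition runs (G : seq nat -> R) : seq nat -> R := chi gtn al (chi ltn be G).

Fixpoint wcount (m : nat) : seq nat -> R :=
  if m is m'.+1 then runs (wcount m') else fun w => (w == [::])%:R.

Lemma wcount_nil m : wcount m [::] = 1.
Proof. by elim: m => // m IH; rewrite /= /runs !chi_nil. Qed.

Lemma wcount_multiplicative m : multiplicative (wcount m).
Proof.
have tot a b : a != b -> (b < a)%N = ~~ (a < b)%N by case: ltngtP.
elim: m => [|m IH] /=.
  case=> [|a u] [|b v] _; rewrite ?(sh0s, shs0) ?big_seq1 ?mul1r ?mulr1 //.
  by rewrite sh_cons big_cat !big_map /= !big1 ?addr0 ?mul0r.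
have tl : transitive ltn := @ltn_trans.
have tg : transitive gtn by move=> a b c /= h1 h2; exact: ltn_trans h2 h1.
apply: chi_multiplicative => //.
- by move=> a b; rewrite eq_sym => /tot /= ->.
- by rewrite chi_nil wcount_nil.
- by apply: chi_multiplicative => //; exact: wcount_nil.
Qed.

Lemma wcount_shuffles m (p q : pword) : disj p q ->
  \sum_(u <- shuffles p q) wcount m u = wcount m p * wcount m q.
Proof.
move=> d; rewrite -wcount_multiplicative ?cat_pw_uniq //.
by rewrite -(perm_big _ (shuffles_sh d)) big_map.
Qed.

End RunCount.

(** * Generating functions *)

Definition fps_coef (m : nat) (f : fps) : rat := f m.

HB.instance Definition _ m := GRing.isZmodMorphism.Build fps rat (fps_coef m)
  (fun f g => erefl).

Fact fps_coef0_monoid : monoid_morphism (fps_coef 0).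
Proof.
by split=> // f g; rewrite /fps_coef fps_mulE big_ord_recl big_ord0 addr0.
Qed.

HB.instance Definition _ :=
  GRing.isMonoidMorphism.Build fps rat (fps_coef 0) fps_coef0_monoid.

Notation ev m := (map_poly (fps_coef m)).

Notation tP := (fps_t%:P).
Notation geomP := ((1 - fps_t)^-1%:P).

Lemma ev_mulX m (f : {poly fps}) : ev m ('X * f) = 'X * ev m f.
Proof.
by apply/polyP => i; rewrite coef_map !coefXM coef_map; case: ifP; rewrite ?raddf0.
Qed.

Lemma ev_mult0 (f : {poly fps}) : ev 0 (tP * f) = 0.
Proof. by rewrite rmorphM /= map_polyC /= /fps_coef mul0r. Qed.

Lemma fps_mult (f : fps) m : (fps_t * f) m.+1 = f m.
Proof.
rewrite fps_mulE big_ord_recl big_ord_recl /= mul0r add0r mul1r subSS subn0.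
by rewrite big1 ?addr0 // => i _; rewrite /fps_t /= mul0r.
Qed.

Lemma subr1t_unit : (1 - fps_t : fps) \is a GRing.unit.
Proof.
apply/asboolP; exists fps_geom; rewrite mulrBr mulr1 [X in _ - X]mulrC.
have subE (f g : fps) m : (f - g) m = f m - g m by [].
apply/funext => -[|m]; rewrite subE; last by rewrite fps_mult subrr.
have -> : (fps_t * fps_geom) 0%N = 0 by rewrite fps_mulE big_ord1 mul0r.
exact: subr0.
Qed.

Lemma geomPK : (1 - tP) * geomP = 1 :> {poly fps}.
Proof. by rewrite -polyC1 -polyCB -polyCM mulrV ?subr1t_unit. Qed.

Lemma mult_geomP : tP * geomP = geomP - 1 :> {poly fps}.
Proof. by rewrite -geomPK; ring. Qed.

Lemma ev_multS m (f : {poly fps}) : ev m.+1 (tP * f) = ev m f.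
Proof. by apply/polyP => i; rewrite !coef_map coefCM; exact: fps_mult. Qed.

Section GeneratingFunction.
Variables (al be : {poly rat}) (A B : {poly fps}).
Hypothesis evA : forall m f, ev m (A * f) = al * ev m f.
Hypothesis evB : forall m f, ev m (B * f) = be * ev m f.

Definition gf_of (f : nat -> {poly rat}) (F : {poly fps}) : Prop :=
  forall m, ev m F = f m.

Definition lead_barred w (m : nat) : {poly rat} :=
  if m is m'.+1 then lead gtn al (chi ltn be (wcount al be m')) w else 0.

Definition lead_unbarred w (m : nat) : {poly rat} :=
  if m is m'.+1 then lead ltn be (wcount al be m') w else 0.

(* [F.1] and [F.2] are the contributions of the maps sending the first letter of
   the word to 1' and to 1. *)
Definition gf_spec w (F : {poly fps} * {poly fps}) (P : {poly fps}) : Prop :=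
  [/\ gf_of (lead_barred w) F.1, gf_of (lead_unbarred w) F.2 &
      gf_of (fun m => wcount al be m w) P].

(** If the first letter is not sent to 1' or 1, no letter is, and lowering all values by one gives
    the term t P. The equation determines the coefficients of P one after another, starting from 0
    as the word is nonempty. *)
Lemma gf_spec_total w F P : w != [::] ->
  gf_of (lead_barred w) F.1 -> gf_of (lead_unbarred w) F.2 ->
  P = tP * P + F.1 + F.2 -> gf_spec w F P.
Proof.
move=> w0 g1 g2 eP; split=> //; elim=> [|m IH]; rewrite eP !raddfD /= g1 g2.
  by rewrite ev_mult0 (negbTE w0) !addr0.
by rewrite ev_multS IH /runs /chi /= -!addrA [X in _ + X]addrC.
Qed.

Lemma gf_spec1 a : gf_spec [:: a] (A * (tP * geomP), B * (tP * geomP))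
  ((A + B) * (tP * geomP * geomP)).
Proof.
have g0 m : ev m (geomP : {poly fps}) = 1.
  by rewrite map_polyC /= /fps_coef fps_geomE.
apply: gf_spec_total => //.
- by case=> [|m]; rewrite /= evA ?ev_mult0 ?ev_multS ?mulr0 // g0 chi_nil wcount_nil addr0.
- by case=> [|m]; rewrite /= evB ?ev_mult0 ?ev_multS ?mulr0 // g0 wcount_nil addr0.
rewrite /=; ring: mult_geomP.
Qed.

(** This is the transfer recursion. When a goes to 1', b goes to 1, or beyond 1, or to 1' as well if
    a > b. When a goes to 1, b goes beyond 1, or to 1 as well if a < b. *)
Lemma gf_spec_cons a b w F P Q : gf_spec (b :: w) F P ->
  let F' := (A * (F.2 + tP * P + (if (b < a)%N then F.1 else 0)),
             B * (tP * P + (if (a < b)%N then F.2 else 0))) in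
  Q = tP * Q + F'.1 + F'.2 -> gf_spec [:: a, b & w] F' Q.
Proof.
case=> g1 g2 g3 F' eQ; apply: gf_spec_total => //.
- case=> [|m]; rewrite /= evA !raddfD /= g2.
    by rewrite ev_mult0 !add0r; case: ifP; rewrite ?raddf0 ?g1 ?mulr0.
  rewrite ev_multS g3 /chi /=; congr (_ * (_ + _)); first by rewrite addrC.
  by case: ifP; rewrite ?raddf0 ?g1.
- case=> [|m]; rewrite /= evB raddfD /=.
    by rewrite ev_mult0 !add0r; case: ifP; rewrite ?raddf0 ?g2 ?mulr0.
  rewrite ev_multS g3 /=; congr (_ * (_ + _)).
  by case: ifP; rewrite ?raddf0 ?g2.
Qed.

End GeneratingFunction.

(** * Peaks and descents *)

(** On plain lists the first letter can be removed without rebuilding a [pword]. *)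
Definition des_seq (s : seq nat) : nat :=
  count (fun i => nth 0 s i.+1 < nth 0 s i)%N (iota 0 (size s).-1).

Definition pk_seq (s : seq nat) : nat :=
  count (fun i => (nth 0 s i.-1 < nth 0 s i) && (nth 0 s i.+1 < nth 0 s i))%N
        (iota 1 (size s).-2).

Lemma des_seq_cons2 a b w : des_seq [:: a, b & w] = ((b < a) + des_seq (b :: w))%N.
Proof. by rewrite /des_seq /= (iotaDl 1 0) count_map. Qed.

(** Prepending a letter smaller than the first creates a peak exactly in this case. *)
Definition head_desc (w : seq nat) : bool :=
  if w is [:: a, b & _] then (b < a)%N else false.
Arguments head_desc : simpl never.

Lemma pk_seq_cons2 a b w :
  pk_seq [:: a, b & w] = ((a < b)%N && head_desc (b :: w) + pk_seq (b :: w))%N.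
Proof.
case: w => [|c w]; first by rewrite /pk_seq /= andbF.
rewrite /pk_seq /= (iotaDl 1 1) count_map; congr (_ + _)%N.
by apply: eq_in_count => -[|i] //; rewrite mem_iota.
Qed.

(** * Closed form of the generating function *)

Section ClosedForm.
Variables (al be : {poly rat}) (A B : {poly fps}).
Hypothesis evA : forall m f, ev m (A * f) = al * ev m f.
Hypothesis evB : forall m f, ev m (B * f) = be * ev m f.

(* [pd_frac] with general weights, for c = des - pk and d = n - pk - des - 1. *)
Definition run_frac (j c d : nat) : {poly fps} :=
  tP ^+ j.+1 * (A + B * tP) ^+ c * (B + A * tP) ^+ d * (A + B) ^+ (2 * j + 1)
    * geomP ^+ (2 * j + c + d + 2).

(** The recursion needs the pair F, not only the total, so the induction also carries the shape of
    F. After an initial descent S is the total of the word without its first letter; after an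
    initial ascent S is [F.2 + tP * P] of that shorter word. *)
Lemma gf_spec_word w : uniq w -> w != [::] -> exists c d F,
  [/\ des_seq w = (pk_seq w + c)%N, size w = (2 * pk_seq w + c + d + 1)%N,
      gf_spec al be w F (run_frac (pk_seq w) c d)
    & if head_desc w then
        exists c' S, [/\ c = c'.+1, F = (A * S, B * (tP * S))
          & S = tP ^+ (pk_seq w).+1 * (A + B * tP) ^+ c' * (B + A * tP) ^+ d
                * (A + B) ^+ (2 * pk_seq w + 1) * geomP ^+ (2 * pk_seq w + c + d + 1)]
      else exists S, F = (A * S, B * S) /\
                     run_frac (pk_seq w) c d = (A + B) * S * geomP].
Proof.
elim: w => [|a [|b w] IH] //.
  move=> _ _; exists 0%N, 0%N, (A * (tP * geomP), B * (tP * geomP)); split=> //.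
    have -> : run_frac (pk_seq [:: a]) 0 0 = (A + B) * (tP * geomP * geomP).
      by rewrite /run_frac /pk_seq /= !expr1 !expr0 !mulr1; ring.
    exact: gf_spec1.
  exists (tP * geomP); split=> //.
  by rewrite /run_frac /pk_seq /= !expr1 !expr0 !mulr1; ring.
move=> /= /andP[an uw] _; have {IH} [c [d [F [eD eN sF sS]]]] := IH uw isT.
have ab : a != b by move: an; rewrite inE negb_or => /andP[].
rewrite des_seq_cons2 pk_seq_cons2 (_ : head_desc [:: a, b & w] = (b < a)%N) //.
set j := pk_seq (b :: w) in eD eN sF sS *.
have := gf_spec_cons evA evB (a := a) sF.
case: (ltngtP a b) ab => //= lt_ab _ sG.
(* An ascent in front of a descent is a new peak: a factor A + B t of the product is traded for t (A
   + B)^2 / (1 - t). *)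
- case: (head_desc (b :: w)) sS.
    move=> [c' [S [ec eF eS]]].
    exists c', d, (A * (S * tP * geomP * (A + B)), B * (S * tP * geomP * (A + B))).
    have eP : run_frac j c d = (A + B * tP) * S * geomP.
      rewrite /run_frac eS ec; rewrite !(addn2, addn1, addnS, exprS) /=. ring.
    have eQ : run_frac (1 + j) c' d = (A + B) * (S * tP * geomP * (A + B)) * geomP.
      rewrite /run_frac eS ec.
      have -> : (2 * (1 + j) + 1 = (2 * j + 1).+2)%N by lia.
      have -> : (2 * (1 + j) + c' + d + 2 = (2 * j + c'.+1 + d + 1).+2)%N by lia.
      rewrite add1n !exprS; ring.
    split; [by rewrite eD /=; lia | by move: eN => /=; lia | |
      by exists (S * tP * geomP * (A + B))].
    have -> : (A * (S * tP * geomP * (A + B)), B * (S * tP * geomP * (A + B))) =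
      (A * (F.2 + tP * run_frac j c d + 0), B * (tP * run_frac j c d + F.2)).
      rewrite eP eF /=; congr pair; ring: mult_geomP.
    apply: sG; rewrite eP eF eQ /=; ring: mult_geomP.
  (* The remaining ascents multiply the product by (B + A t) / (1 - t). *)
  move=> [S [eF eP]].
  exists c, d.+1, (A * (S * geomP * (B + A * tP)), B * (S * geomP * (B + A * tP))).
  have eQ : run_frac j c d.+1 = (A + B) * (S * geomP * (B + A * tP)) * geomP.
    transitivity (run_frac j c d * (B + A * tP) * geomP); last by rewrite eP; ring.
    rewrite /run_frac (_ : 2 * j + c + d.+1 + 2 = (2 * j + c + d + 2).+1)%N; last by lia.
    rewrite !exprS; ring.
  split; [by rewrite eD /=; lia | by move: eN => /=; lia | | by exists (S * geomP * (B + A * tP))].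
  have -> : (A * (S * geomP * (B + A * tP)), B * (S * geomP * (B + A * tP))) =
    (A * (F.2 + tP * run_frac j c d + 0), B * (tP * run_frac j c d + F.2)).
    rewrite eP eF /=; congr pair; ring: mult_geomP.
  apply: sG; rewrite eP eF eQ /=; ring: mult_geomP.
(* A descent multiplies the product by (A + B t) / (1 - t): by this equation for the tail, the
   barred entry is A times its total. *)
- have eF : run_frac j c d = tP * run_frac j c d + F.1 + F.2.
    move: sS; case: (head_desc _) => [[c' [S [ec eF eS]]]|[S [eF ->]]]; last first.
      by rewrite eF /=; ring: mult_geomP.
    have -> : run_frac j c d = (A + B * tP) * S * geomP.
      rewrite /run_frac eS ec; rewrite !(addn2, addn1, addnS, exprS) /=. ring.
    rewrite eF /=; ring: mult_geomP.
  exists c.+1, d, (A * run_frac j c d, B * (tP * run_frac j c d)).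
  have eQ : run_frac j c.+1 d = (A + B * tP) * run_frac j c d * geomP.
    rewrite /run_frac (_ : 2 * j + c.+1 + d + 2 = (2 * j + c + d + 2).+1)%N; last by lia.
    rewrite !exprS; ring.
  split; [by rewrite eD /=; lia | by move: eN => /=; lia | |
    by exists c, (run_frac j c d); split=> //;
       rewrite /run_frac (_ : 2 * j + c.+1 + d + 1 = 2 * j + c + d + 2)%N; last by lia].
  have -> : (A * run_frac j c d, B * (tP * run_frac j c d)) =
    (A * (F.2 + tP * run_frac j c d + F.1), B * (tP * run_frac j c d + 0)).
    by rewrite addr0; congr (A * _, _); rewrite {1}eF; ring.
  apply: sG; rewrite eQ /=.
  rewrite (_ : F.2 + _ + F.1 = run_frac j c d); last by rewrite [RHS]eF; ring.
  ring: mult_geomP.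
Qed.

Lemma gf_word w : uniq w -> w != [::] -> exists c d,
  [/\ des_seq w = (pk_seq w + c)%N, size w = (2 * pk_seq w + c + d + 1)%N
    & forall m, ev m (run_frac (pk_seq w) c d) = wcount al be m w].
Proof.
by move=> uw w0; have [c [d [F [e1 e2 [_ _ g] _]]]] := gf_spec_word uw w0; exists c, d.
Qed.

End ClosedForm.

(** * The possible values of size, peaks and descents *)

Lemma pkE (p : pword) : pk p = pk_seq p.
Proof. by []. Qed.

Lemma desE (p : pword) : des p = des_seq p.
Proof. by []. Qed.

(** The bounds express that c and d in [gf_word] are natural numbers; it is instantiated with both
    weights equal to 1. *)
Lemma des_pk_bounds (p : pword) : (0 < size p)%N ->
  (pk p <= des p)%N && (pk p + des p < size p)%N.
Proof.
move=> p0; have w0 : (p : seq nat) != [::] by rewrite -size_eq0 -lt0n.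
have e1 m (f : {poly fps}) : ev m (1 * f) = 1 * ev m f by rewrite !mul1r.
have [c [d [+ + _]]] := gf_word e1 e1 (pw_uniq p) w0.
by rewrite desE pkE => -> ->; rewrite leq_addr /=; lia.
Qed.

Lemma exists_desc_cons (p : pword) : (0 < size p)%N ->
  exists q : pword, [/\ size q = (size p).+1, pk q = pk p, des q = (des p).+1
                      & head_desc q].
Proof.
case ep: {1}(p : seq nat) => [|a w] // _.
have gt_all x : x \in (p : seq nat) -> (x < (maxw p).+1)%N.
  by move=> xp; rewrite ltnS; exact: (@leq_bigmax_seq _ p xpredT id x xp isT).
move: (maxw p) gt_all => m gt_all.
have hq : uniq (m.+1 :: p) && all (leq 1) (m.+1 :: p).
  rewrite cons_uniq pw_uniq /= pw_pos !andbT.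
  by apply/negP => /gt_all; rewrite ltnn.
have ga : (a < m.+1)%N by apply: gt_all; rewrite ep inE eqxx.
exists (Pword hq); split=> //; last by move: ga; rewrite /head_desc /= ep.
- rewrite !pkE /= ep pk_seq_cons2.
  by rewrite ltnNge (ltnW ga).
- rewrite !desE /= ep des_seq_cons2 ga.
  by rewrite add1n.
Qed.

(** All letters are raised by one to make room for a new first letter 1, below all others. *)
Lemma exists_asc_cons (p : pword) : (0 < size p)%N ->
  exists q : pword, [/\ size q = (size p).+1, pk q = (head_desc p + pk p)%N
                      & des q = des p].
Proof.
have [p' [<- <- <- <- gt1]] : exists p' : pword,
    [/\ size p' = size p, pk p' = pk p, des p' = des p, head_desc p' = head_desc p
      & forall x, x \in (p' : seq nat) -> (1 < x)%N].
  have so := same_order_shift 1 p.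
  exists (shiftw 1 p); have /= [-> ->] := statP pkdes so.
  split=> //; [by case: so | by case: (p : seq nat) => [|a [|b w]] |].
  by move=> x /mapP[y /(allP (pw_pos p)) y0 ->]; rewrite add1n ltnS.
have hq : uniq (1%N :: p') && all (leq 1) (1%N :: p').
  rewrite cons_uniq /= pw_uniq pw_pos !andbT.
  by apply/negP => /gt1.
move=> p0; exists (Pword hq); move: p0; rewrite !pkE !desE /=.
case ep: (pw_seq p') => [|a w] // _.
have a1 : (1 < a)%N by apply: gt1; rewrite ep inE eqxx.
by rewrite pk_seq_cons2 des_seq_cons2 a1 ltnNge (ltnW a1).
Qed.

(** Built from the right: d minima are prepended to a single letter, then c maxima, then j times a
    maximum followed by a minimum. Each such pair adds two letters, one peak and one descent. *)
Lemma exists_pword j c d : exists p : pword,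
  [/\ size p = (2 * j + c + d + 1)%N, pk p = j & des p = (j + c)%N].
Proof.
elim: j => [|j [p [sp pp dp]]]; last first.
  have p0 : (0 < size p)%N by rewrite sp; lia.
  have [q [sq pq dq hq]] := exists_desc_cons p0.
  have q0 : (0 < size q)%N by rewrite sq.
  have [r [sr pr dr]] := exists_asc_cons q0.
  by exists r; rewrite sr pr dr hq sq pq dq sp pp dp; split; lia.
elim: c => [|c [p [sp pp dp]]]; last first.
  have p0 : (0 < size p)%N by rewrite sp; lia.
  have [q [sq pq dq hq]] := exists_desc_cons p0.
  by exists q; rewrite sq pq dq sp pp dp; split; lia.
suff [p [sp pp dp hp]] : exists p : pword,
    [/\ size p = d.+1, pk p = 0%N, des p = 0%N & head_desc p = false].
  by exists p; split; rewrite ?sp ?pp ?dp; lia.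
elim: d => [|d [p [sp pp dp hp]]]; first by exists (@Pword [:: 1%N] isT).
have p0 : (0 < size p)%N by rewrite sp.
have [q [sq pq dq]] := exists_asc_cons p0.
exists q; split; rewrite ?sq ?pq ?dq ?hp ?pp ?sp ?dp //.
have q0 : (0 < size q)%N by rewrite sq.
move: dq; rewrite dp desE /head_desc.
case: (q : seq nat) => [|a [|b w]] //.
by rewrite des_seq_cons2; case: (b < a)%N.
Qed.

Lemma ev_multX_low j m f : (m < j)%N -> ev m (tP ^+ j * f) = 0.
Proof.
elim: j m => [|j IH] [|m] // mj; rewrite exprS -mulrA; first exact: ev_mult0.
by rewrite ev_multS IH.
Qed.

Lemma ev_multX j f : ev j (tP ^+ j * f) = ev 0 f.
Proof. by elim: j => [|j IH]; rewrite ?mul1r // exprS -mulrA ev_multS. Qed.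

(** * Lowest coefficients in t *)

Section LeadingTerm.
Variables (be : {poly rat}) (B : {poly fps}).
Hypothesis evB : forall m f, ev m (B * f) = be * ev m f.
Hypothesis be1 : be`_0 = 1.

Lemma wcount_low (p : pword) m : (0 < size p)%N -> (m <= pk p)%N ->
  wcount 'X be m p = 0.
Proof.
move=> p0 mp; have w0 : (p : seq nat) != [::] by rewrite -size_eq0 -lt0n.
have [c [d [_ _ g]]] := gf_word ev_mulX evB (pw_uniq p) w0.
by rewrite -g /run_frac -!mulrA ev_multX_low // ltnS -pkE.
Qed.

(** Dividing [run_frac] by t^(pk+1) and setting t = 0 leaves y^c be^d (y + be)^(2 pk + 1), where
    [be] has constant term 1. *)
Lemma wcount_lead (p : pword) : (0 < size p)%N ->
  exists h : {poly rat}, h`_0 = 1 /\ wcount 'X be (pk p).+1 p = 'X^(des p - pk p) * h.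
Proof.
move=> p0; have w0 : (p : seq nat) != [::] by rewrite -size_eq0 -lt0n.
have [c [d [eD _ g]]] := gf_word ev_mulX evB (pw_uniq p) w0.
have -> : (des p - pk p = c)%N by rewrite desE eD addKn.
have ev0t : ev 0 (tP : {poly fps}) = 0 by rewrite map_polyC.
have ev0X : ev 0 ('X : {poly fps}) = 'X by rewrite map_polyX.
have ev0B : ev 0 B = be by rewrite -[B]mulr1 evB rmorph1 mulr1.
have ev0g : ev 0 (geomP : {poly fps}) = 1.
  by rewrite map_polyC /= /fps_coef fps_geomE.
exists (be ^+ d * ('X + be) ^+ (2 * pk p + 1)); split.
  by rewrite -horner_coef0 !hornerE /= horner_coef0 be1 ?add0r !expr1n mul1r.
rewrite -g /run_frac -pkE -!mulrA ev_multX !rmorphM !rmorphXn !rmorphD !rmorphM /=.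
by rewrite ev0t ev0X ev0B ev0g !mulr0 !addr0 expr1n mulr1.
Qed.

End LeadingTerm.

(** * Linear independence *)

Section Triangularity.
Variables (V : lmodType rat) (F : pword -> V).
Variables (be : {poly rat}) (B : {poly fps}) (th : nat -> {poly rat}).
Variable (evV : nat -> nat -> V -> {poly rat}).
Hypothesis evB : forall m f, ev m (B * f) = be * ev m f.
Hypothesis be1 : be`_0 = 1.
Hypothesis th1 : forall n, (th n)`_0 = 1.
Hypothesis evV_linear : forall n m c a b,
  evV n m (c *: a + b) = c *: evV n m a + evV n m b.
Hypothesis evVF : forall n m p,
  evV n m (F p) = if size p == n then wcount 'X be m p * th n else 0.

(** Both images are treated at once: [evV n m] reads off the x^n part at index m, and [th n] is a
    correction factor, 1 for power series and coming from (1 + y)^n for polynomials. *)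
Definition lead_coefficient (p : pword) (v : V) : rat :=
  (evV (size p) (pk p).+1 v)`_(des p - pk p).

Fact lead_coefficient_linear p : scalar (lead_coefficient p).
Proof. by move=> c a b; rewrite /lead_coefficient evV_linear coefD coefZ. Qed.

HB.instance Definition _ p :=
  GRing.isLinear.Build rat V rat *%R (lead_coefficient p) (lead_coefficient_linear p).

Lemma lead_coefficient_id (p q : pword) : size q = size p -> pk q = pk p -> des q = des p ->
  lead_coefficient p (F q) = 1.
Proof.
rewrite /lead_coefficient evVF => es ep ed; rewrite es eqxx -ep -ed.
case: (posnP (size p)) => [p0|p0].
  have q0 : (q : seq nat) = [::] by apply: size0nil; rewrite es.
  by rewrite pkE desE q0 wcount_nil mul1r.
have [h [h1 ->]] := wcount_lead evB be1 (etrans (congr1 _ es) p0).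
by rewrite -mulrA coefXnM ltnn subnn coefM big_ord1 h1 th1 mulr1.
Qed.

Lemma lead_coefficient0 (p q : pword) : lead_coefficient p (F q) != 0 ->
  size q = size p /\ ((pk q < pk p)%N \/ pk q = pk p /\ (des q <= des p)%N).
Proof.
rewrite /lead_coefficient evVF; case: (size q =P size p) => [es|_]; last by rewrite coef0 eqxx.
move=> nz; split=> //; move: nz; case: (posnP (size p)) => [p0|p0].
  have q0 : (q : seq nat) = [::] by apply: size0nil; rewrite es.
  have e0 : (p : seq nat) = [::] by apply: size0nil.
  by right; rewrite !pkE !desE q0 e0.
have q0 : (0 < size q)%N by rewrite es.
case: (ltngtP (pk q) (pk p)) => [|lt|epk]; first by left.
  by rewrite (wcount_low evB q0 lt) mul0r coef0 eqxx.
right; split=> //; move: nz; rewrite -epk.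
have [h [h1 ->]] := wcount_lead evB be1 q0.
rewrite -mulrA coefXnM; case: ltnP => // le _.
have /andP[dq _] := des_pk_bounds q0; have /andP[dp _] := des_pk_bounds p0.
rewrite -epk in dp; lia.
Qed.

(* Triangularity: [lead_coefficient p] vanishes on the images of the classes of
   size [size p] with lexicographically larger (pk, des). *)
Lemma lext_injective (a : {malg rat[st_class pkdes]}) :
  lext (fun k => F (st_repr k)) a = 0 -> a = 0.
Proof.
move=> a0; suff az : forall j d k, pk (st_repr k) = j -> des (st_repr k) = d ->
    a@_k = 0 by apply/malgP => k; rewrite mcoeff0 (az _ _ k erefl erefl).
elim/ltn_ind => j IHj; elim/ltn_ind => d IHd k ej ed.
case ka: (k \in msupp a); last by rewrite mcoeff_outdom ?ka.
have := congr1 (lead_coefficient (st_repr k)) a0.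
rewrite linear0 /lext linear_sum (bigD1_seq k) ?fset_uniq //=.
rewrite linearZ /= lead_coefficient_id // mulr1 big1 ?addr0 // => l lk.
rewrite linearZ /=; apply/eqP; rewrite mulf_eq0.
have [e0|/lead_coefficient0] :=
  eqVneq (lead_coefficient (st_repr k) (F (st_repr l))) 0.
  by apply/orP; right; apply/eqP.
case=> es [lt|[ep le]]; apply/orP; left; apply/eqP.
  by apply: (IHj (pk (st_repr l))) => //; rewrite -ej.
have [e|ne] := eqVneq (des (st_repr l)) (des (st_repr k)); last first.
  by apply: (IHd (des (st_repr l))); rewrite -?ed ?ep // ltn_neqAle ne le.
case/eqP: lk; rewrite -[l]st_reprK -[k]st_reprK; apply/eqP/(st_piP pkdes).
by split=> //=; rewrite ep e.
Qed.

End Triangularity.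

Section ClassFunction.
Variables (T : eqType) (st : statistic T).

(** All words have the same size, so the coefficient at a class is the multiplicity of its value of
    [st]. Equations between sums of classes thus become equalities of multisets. *)
Lemma sum_cls_perm_eq n (s s' : seq pword) :
  all (fun u : pword => size u == n) (s ++ s') ->
  \sum_(u <- s) << st_pi st u >> = \sum_(u <- s') << st_pi st u >> :> {malg rat[st_class st]} ->
  perm_eq [seq st u | u <- s] [seq st u | u <- s'].
Proof.
move=> sz /malgP e; apply/allP => x /=; rewrite -map_cat => /mapP[p ps ->].
have cE (l : seq pword) : {subset l <= s ++ s'} ->
    ((\sum_(u <- l) << st_pi st u >> : {malg rat[st_class st]})@_(st_pi st p)) =
    (count (pred1 (st p)) [seq st u | u <- l])%:R.
  elim: l => [|u l IH] sub; first by rewrite big_nil mcoeff0.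
  rewrite big_cons mcoeffD mcoeffU IH => [|v vl]; last by apply: sub; rewrite inE vl orbT.
  rewrite /= natrD; congr (_%:R + _).
  have us : u \in s ++ s' by apply: sub; rewrite inE eqxx.
  have su : size u = size p by rewrite (eqP (allP sz _ us)) (eqP (allP sz _ ps)).
  by congr nat_of_bool; apply/(st_piP st)/eqP => [[]|].
have := e (st_pi st p); rewrite !cE => [/eqP|u us|u us]; last 2 first.
- by rewrite mem_cat us orbT.
- by rewrite mem_cat us.
by rewrite Num.Theory.eqr_nat.
Qed.

End ClassFunction.

(** * Algebra maps out of the shuffle algebra *)

Section Span.
Variable (V : lmodType rat).
Implicit Types (S : set V).

Lemma Qspan_gen S v : S v -> Qspan S v.
Proof.
by move=> Sv; exists 1%N, (fun=> 1), (fun=> v); split=> //; rewrite big_ord1 scale1r.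
Qed.

Lemma Qspan0 S : Qspan S 0.
Proof.
exists 0%N, (fun=> 0), (fun=> 0); split; last by rewrite big_ord0.
by case.
Qed.

Lemma Qspan_lin S c u v : Qspan S u -> Qspan S v -> Qspan S (c *: u + v).
Proof.
case=> n [a [x [Sx ->]]] [m [b [y [Sy ->]]]].
exists (n + m)%N, (fun i => match fintype.split i with inl i => c * a i | inr i => b i end),
  (fun i => match fintype.split i with inl i => x i | inr i => y i end); split.
  by move=> i; case: fintype.split.
rewrite big_split_ord scaler_sumr /=; congr (_ + _); apply: eq_bigr => i _.
  by rewrite (unsplitK (inl i)) scalerA.
by rewrite (unsplitK (inr i)).
Qed.

Lemma Qspan_ind S (P : V -> Prop) : P 0 ->
  (forall c u v, P u -> P v -> P (c *: u + v)) -> (forall v, S v -> P v) ->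
  forall v, Qspan S v -> P v.
Proof.
move=> P0 PD PS _ [n [c [b [Sb ->]]]].
by elim/big_rec: _ => // i v _ Pv; apply: PD => //; apply: PS.
Qed.

Lemma Qspan_sum S (I : Type) (r : seq I) (c : I -> rat) (b : I -> V) :
  (forall i, Qspan S (b i)) -> Qspan S (\sum_(i <- r) c i *: b i).
Proof.
by move=> Sb; elim/big_rec: _ => [|i v _]; [exact: Qspan0 | exact: Qspan_lin].
Qed.

Lemma Qspan_sub S S' : S `<=` Qspan S' -> Qspan S `<=` Qspan S'.
Proof.
move=> sub; apply: Qspan_ind => //; [exact: Qspan0 | exact: Qspan_lin].
Qed.

End Span.

Lemma shuffle_alg_ind (T : eqType) (st : statistic T) (h : shuffle_compatible st)
    (P : shuffle_alg h -> Prop) :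
  P 0 -> (forall c a b, P a -> P b -> P (c *: a + b)) ->
  (forall p, P (cls h p)) -> forall a, P a.
Proof.
move=> P0 PD PU; apply: malg_lin_ind => // k.
by rewrite -[k]st_reprK; exact: PU.
Qed.

(** By bilinearity classes suffice, and shifting the second word makes it disjoint from the first
    without changing its class. *)
Lemma linear_cls_mul (T : eqType) (st : statistic T) (h : shuffle_compatible st)
    (A : algType rat) (f : shuffle_alg h -> A) :
  (forall c a b, f (c *: a + b) = c *: f a + f b) ->
  (forall p q, disj p q -> f (cls h p * cls h q) = f (cls h p) * f (cls h q)) ->
  forall a b, f (a * b) = f a * f b.
Proof.
move=> lin fmul.
have f0 : f 0 = 0 by have := lin (-1) 0 0; rewrite scaler0 addr0 scaleN1r addNr.
move=> a b; elim/shuffle_alg_ind: a => [|c a a' IH IH'|p].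
- by rewrite mul0r f0 mul0r.
- by rewrite mulrDl -scalerAl (lin c a a') (lin c (a * b)) mulrDl -scalerAl -IH -IH'.
elim/shuffle_alg_ind: b => [|c a a' IH IH'|q0].
- by rewrite mulr0 f0 mulr0.
- by rewrite mulrDr -scalerAr (lin c a a') (lin c (_ * a)) mulrDr -scalerAr -IH -IH'.
have [q [dpq ->]] : exists q, disj p q /\ cls h q0 = cls h q.
  exists (shiftw (maxw p) q0); split; first exact: disj_shift.
  by rewrite /cls pi_shift.
exact: fmul.
Qed.

Section AlgebraMap.
Variables (A : algType rat) (F : pword -> A).
Hypothesis F_class : forall p q : pword, size p = size q -> pkdes p = pkdes q -> F p = F q.
Hypothesis F_nil : F pw_nil = 1.
Hypothesis F_mul : forall p q, disj p q -> \sum_(u <- shuffles p q) F u = F p * F q.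

Let F_repr (k : st_class pkdes) : A := F (st_repr k).

Lemma F_reprE p : F_repr (st_pi pkdes p) = F p.
Proof.
have [es ep] : size (st_repr (st_pi pkdes p)) = size p /\
    pkdes (st_repr (st_pi pkdes p)) = pkdes p by apply/st_piP; rewrite st_reprK.
exact: F_class.
Qed.

Section Injective.
Hypothesis F_inj : forall a, lext F_repr a = 0 -> a = 0.

(** The linear extension of F lives on the free module on classes, which is available before any
    product is. Both sums of shuffles have the same image F p F q, so injectivity identifies
    them. *)
Lemma pkdes_shuffle_compatible : shuffle_compatible pkdes.
Proof.
move=> p q p' q' dpq dpq' sp sq tp tq.
apply: (@sum_cls_perm_eq _ pkdes (size p + size q)).
  apply/allP => u; rewrite mem_cat => /orP[] /size_shuffle ->; rewrite ?sp ?sq //.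
apply/eqP; rewrite -subr_eq0; apply/eqP/F_inj.
have lextE (s : seq pword) :
    lext F_repr (\sum_(u <- s) << st_pi pkdes u >>) = \sum_(u <- s) F u.
  rewrite (linear_sum (lext F_repr)); apply: eq_bigr => u _.
  by rewrite -[RHS]F_reprE; exact: lextU.
by rewrite linearB /= !lextE !F_mul // (F_class sp tp) (F_class sq tq) subrr.
Qed.

End Injective.

Variable h : shuffle_compatible pkdes.

Definition class_map (a : shuffle_alg h) : A := lext F_repr a.

HB.instance Definition _ :=
  GRing.isLinear.Build rat (shuffle_alg h) A *:%R class_map (lext_linear F_repr).

Lemma class_map_cls p : class_map (cls h p) = F p.
Proof. by rewrite /class_map lextU F_reprE. Qed.

Fact class_map_monoid : monoid_morphism class_map.
Proof.
split; first exact: etrans (class_map_cls _) F_nil.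
apply: linear_cls_mul => [c a b|p q dpq]; first exact: lext_linear.
rewrite !class_map_cls -F_mul // cls_mul //.
apply: etrans (linear_sum class_map _ _ _) _.
by apply: eq_bigr => u _; exact: class_map_cls.
Qed.

HB.instance Definition _ :=
  GRing.isMonoidMorphism.Build (shuffle_alg h) A class_map class_map_monoid.

Lemma class_map_range : range class_map = Qspan (range F).
Proof.
apply/seteqP; split=> [_ [a _ <-]|v].
  elim/shuffle_alg_ind: a => [|c a b IH IH'|p].
  - by rewrite linear0; exact: Qspan0.
  - by rewrite linearP; exact: Qspan_lin.
  - by rewrite class_map_cls; apply: Qspan_gen; exists p.
elim/Qspan_ind => [|c _ _ [a _ <-] [b _ <-]|_ [p _ <-]].
- by exists 0; rewrite ?linear0.
- by exists (c *: a + b); rewrite ?linearP.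
- by exists (cls h p); rewrite ?class_map_cls.
Qed.

Lemma class_map_iso S : (forall a, lext F_repr a = 0 -> a = 0) ->
    Qspan (range F) = S ->
  subalgebra S /\ exists phi : {lrmorphism shuffle_alg h -> A},
    (forall p, phi (cls h p) = F p) /\ set_bij [set: shuffle_alg h] S phi.
Proof.
move=> F_inj <-; rewrite -class_map_range; split.
  split=> [|c u v|u v]; rewrite !in_setE.
  - by exists 1; rewrite ?rmorph1.
  - by case=> a _ <- [b _ <-]; exists (c *: a + b); rewrite ?linearP.
  - by case=> a _ <- [b _ <-]; exists (a * b); rewrite ?rmorphM.
exists class_map; split; first exact: class_map_cls.
split; [by move=> a _; exists a | | by []].
move=> a b _ _ /eqP; rewrite -subr_eq0 -linearB => /eqP /F_inj /eqP.
by rewrite subr_eq0 => /eqP.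
Qed.

End AlgebraMap.

(** * The image in power series *)

Definition hfps_coef (m : nat) (f : hfps) : rat := f m.

HB.instance Definition _ m := GRing.isZmodMorphism.Build hfps rat (hfps_coef m)
  (fun f g => erefl).

Fact hfps_coef_monoid m : monoid_morphism (hfps_coef m).
Proof. by []. Qed.

HB.instance Definition _ m :=
  GRing.isMonoidMorphism.Build hfps rat (hfps_coef m) (hfps_coef_monoid m).

(** For the Hadamard product each coefficient in t is a ring morphism, so identities can be checked
    one index m at a time. *)
Lemma hfps_coef_inj (f g : {poly hfps}) :
  (forall m, map_poly (hfps_coef m) f = map_poly (hfps_coef m) g) -> f = g.
Proof.
move=> e; apply/polyP => i; apply/funext => m.
by have /polyP/(_ i) := e m; rewrite !coef_map.
Qed.

Definition pd_gf (p : pword) : {poly fps} :=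
  if size p == 0%N then geomP else pd_frac (size p) (pk p) (des p).

Lemma pd_imageE p : pd_image p = hpoly (pd_gf p) * 'X^(size p).
Proof.
by rewrite /pd_image /pd_gf; case: ifP => // /eqP ->; rewrite expr0 mulr1.
Qed.

Lemma ev_pd_gf m p : ev m (pd_gf p) = wcount 'X 1 m p.
Proof.
rewrite /pd_gf; case: ifP => [/eqP/size0nil ->|/negbT sz].
  by rewrite wcount_nil map_polyC /= /fps_coef fps_geomE.
have e1 k (f : {poly fps}) : ev k (1 * f) = 1 * ev k f by rewrite !mul1r.
have w0 : (p : seq nat) != [::] by rewrite -size_eq0.
have [c [d [eD eN <-]]] := gf_word ev_mulX e1 (pw_uniq p) w0.
rewrite /run_frac /pd_frac -pkE; rewrite -pkE -desE in eD; rewrite -pkE in eN.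
have -> : (des p - pk p = c)%N by rewrite eD addKn.
have -> : (size p - pk p - des p - 1 = d)%N by rewrite eN eD; lia.
have -> : (2 * pk p + c + d + 2 = (size p).+1)%N by rewrite eN; lia.
by rewrite -exprVn polyC_exp mul1r ['X + 1]addrC.
Qed.

Lemma map_hfps_coef m (f : {poly fps}) :
  map_poly (hfps_coef m) (map_poly to_hfps f) = ev m f.
Proof. by apply/polyP => i; rewrite !coef_map. Qed.

Lemma pd_image_class (p q : pword) :
  size p = size q -> pkdes p = pkdes q -> pd_image p = pd_image q.
Proof. by rewrite /pd_image => -> [-> ->]. Qed.

Lemma pd_image_nil : pd_image pw_nil = 1.
Proof. by rewrite pd_imageE mulr1 /pd_gf /= /hpoly map_polyC /= to_hfps_geom. Qed.

Lemma pd_image_mul p q : disj p q ->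
  \sum_(u <- shuffles p q) pd_image u = pd_image p * pd_image q.
Proof.
move=> d; pose H u := map_poly to_hfps (pd_gf u).
have HM : \sum_(u <- shuffles p q) H u = H p * H q.
  apply: hfps_coef_inj => m; rewrite rmorph_sum rmorphM /= !map_hfps_coef !ev_pd_gf.
  rewrite -wcount_shuffles //; apply: eq_bigr => u _.
  by rewrite map_hfps_coef ev_pd_gf.
rewrite !pd_imageE mulrACA -exprD -polyCM -/(H p) -/(H q) -HM rmorph_sum mulr_suml.
rewrite big_seq [RHS]big_seq; apply: eq_bigr => u /size_shuffle su.
by rewrite pd_imageE su.
Qed.

Definition Qtxy_ev (n m : nat) (f : Qtxy) : {poly rat} :=
  map_poly (hfps_coef m) f`_n.

Lemma Qtxy_ev_linear n m c f g :
  Qtxy_ev n m (c *: f + g) = c *: Qtxy_ev n m f + Qtxy_ev n m g.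
Proof.
rewrite /Qtxy_ev coefD raddfD /=; congr (_ + _).
apply/polyP => i; rewrite coefZ !coef_map; exact: Qtxy_scaleE.
Qed.

Lemma Qtxy_ev_pd_image n m p :
  Qtxy_ev n m (pd_image p) = if size p == n then wcount 'X 1 m p * 1 else 0.
Proof.
rewrite pd_imageE /Qtxy_ev coefMXn /hpoly coefC subn_eq0.
case: (ltngtP (size p) n) => _; rewrite ?rmorph0 //.
by rewrite map_hfps_coef ev_pd_gf mulr1.
Qed.

Lemma pd_image_inj (a : {malg rat[st_class pkdes]}) :
  lext (fun k => pd_image (st_repr k)) a = 0 -> a = 0.
Proof.
have e1 m (f : {poly fps}) : ev m (1 * f) = 1 * ev m f by rewrite !mul1r.
apply: (@lext_injective _ _ 1 1 (fun=> 1) Qtxy_ev) => //.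
- by rewrite coef1.
- by move=> _; rewrite coef1.
- exact: Qtxy_ev_linear.
- exact: Qtxy_ev_pd_image.
Qed.

Lemma pd_image_span : Qspan (range pd_image) = pd_span.
Proof.
congr Qspan; apply/seteqP; split=> [_ [p _ <-]|f].
  rewrite /pd_image; case: posnP => [//|p0]; first by left.
  right; exists (size p), (pk p), (des p); have := des_pk_bounds p0.
  by case/andP => h1 h2; split=> //; lia.
case=> [->|[n [j [k [n0 hj hk ->]]]]].
  by exists pw_nil; rewrite // /pd_image.
have [p [sp pp dp]] := exists_pword j (k - j) (n - j - k - 1).
have sn : size p = n by rewrite sp; lia.
exists p => //; rewrite /pd_image sn pp dp subnKC; last by lia.
by rewrite eqn0Ngt n0.
Qed.

(** * The image in polynomials *)

(* [ehrhart b] is the polynomial whose value at m is the coefficient of t^m in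
   t (1+t)^b / (1-t)^(b+2); its three-term recurrence is the effect of t d/dt on
   this series. *)
Fixpoint ehrhart_pair (b : nat) : {poly rat} * {poly rat} :=
  if b is b'.+1 then
    let: (f, g) := ehrhart_pair b' in
    (g, b.+2%:R^-1 *: (('X * g) *+ 2 + f *+ b))
  else ('X, 'X^2).

Definition ehrhart b := (ehrhart_pair b).1.

Lemma ehrhart0 : ehrhart 0 = 'X. Proof. by []. Qed.

Lemma ehrhart1 : ehrhart 1 = 'X^2. Proof. by []. Qed.

Lemma ehrhartSS b :
  ehrhart b.+2 = b.+3%:R^-1 *: (('X * ehrhart b.+1) *+ 2 + ehrhart b *+ b.+1).
Proof. by rewrite /ehrhart /=; case: (ehrhart_pair b). Qed.

Lemma ehrhartSS_horner b x : b.+3%:R * (ehrhart b.+2).[x] =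
  2%:R * (x * (ehrhart b.+1).[x]) + b.+1%:R * (ehrhart b).[x].
Proof.
rewrite ehrhartSS hornerZ mulrA mulfV ?Num.Theory.pnatr_eq0 // mul1r.
by rewrite hornerD !hornerMn hornerM hornerX !mulr_natl.
Qed.

(** With g_b the series of [ehrhart b], the first identity is (1 - t) g_(b+1) = (1 + t) g_b on
    coefficients. The second, a consequence of applying t d/dt to g_b, makes the induction close. *)
Lemma ehrhart_shift b x :
  (ehrhart b.+1).[x + 1] - (ehrhart b.+1).[x] = (ehrhart b).[x + 1] + (ehrhart b).[x]
  /\ b.+2%:R * (ehrhart b.+1).[x] =
     x * (ehrhart b).[x + 1] + (x - b.+1%:R) * (ehrhart b).[x].
Proof.
elim: b => [|b [IH1 IH2]].
  rewrite ehrhart1 ehrhart0 !hornerXn !hornerX; by split; ring.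
have e1 := ehrhartSS_horner b x; have e2 := ehrhartSS_horner b (x + 1).
have J : b.+3%:R * (ehrhart b.+2).[x] =
    x * (ehrhart b.+1).[x + 1] + (x - b.+2%:R) * (ehrhart b.+1).[x].
  rewrite e1; move: IH2 IH1.
  rewrite -[b.+2%:R]natr1 -[b.+1%:R]natr1.
  set f := (ehrhart b).[x]; set f' := (ehrhart b).[x + 1].
  set g := (ehrhart b.+1).[x]; set g' := (ehrhart b.+1).[x + 1] => IH2 IH1.
  have -> : g' = g + f' + f by rewrite -addrA -IH1 addrC subrK.
  have -> : (b%:R + 1) * f = x * (f' + f) - (b%:R + 1 + 1) * g by rewrite IH2; ring.
  by ring.
split=> //.
have nz : b.+3%:R != 0 :> rat by rewrite Num.Theory.pnatr_eq0.
apply: (mulfI nz); rewrite mulrBr J e2.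
move: IH2 IH1; rewrite -[b.+3%:R]natr1 -[b.+2%:R]natr1 -[b.+1%:R]natr1.
set f := (ehrhart b).[x]; set f' := (ehrhart b).[x + 1].
set g := (ehrhart b.+1).[x]; set g' := (ehrhart b.+1).[x + 1] => IH2 IH1.
have -> : g' = g + f' + f by rewrite -addrA -IH1 addrC subrK.
(* [IH2] is needed once with coefficient 1, so its vanishing form is added to the left side. *)
have e : (b%:R + 1 + 1) * g - (x * f' + (x - (b%:R + 1)) * f) = 0 by rewrite IH2 subrr.
rewrite -[LHS]addr0 -e; ring.
Qed.

Lemma ehrhart_at0 b : (ehrhart b).[0] = 0.
Proof.
suff [] : (ehrhart b).[0] = 0 /\ (ehrhart b.+1).[0] = 0 by [].
elim: b => [|b [IH IH1]]; first by rewrite ehrhart1 ehrhart0 hornerXn hornerX expr0n.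
split=> //; apply: (mulfI (_ : b.+3%:R != 0 :> rat)).
  by rewrite Num.Theory.pnatr_eq0.
by rewrite ehrhartSS_horner IH mul0r !mulr0 addr0.
Qed.

Notation ratioP := ((1 + tP) * geomP).

(** Induction on b and, inside it, on m: (1 - t) g_(b+1) = (1 + t) g_b expresses the coefficient at
    m + 1 by earlier ones. *)
Lemma ev_ehrhart b m :
  ev m (tP * geomP ^+ 2 * ratioP ^+ b) = (ehrhart b).[m%:R]%:P.
Proof.
elim: b m => [|b IH]; elim=> [|m IHm].
- by rewrite -mulrA ev_mult0 ehrhart0 hornerX polyC0.
- have -> : tP * geomP ^+ 2 * ratioP ^+ 0 =
      tP * (tP * geomP ^+ 2 * ratioP ^+ 0) + tP * geomP.
    by rewrite !expr0; ring: mult_geomP.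
  rewrite raddfD /= !ev_multS IHm map_polyC /= /fps_coef fps_geomE.
  by rewrite ehrhart0 !hornerX -natr1 polyCD.
- by rewrite -mulrA ev_mult0 ehrhart_at0.
have -> : tP * geomP ^+ 2 * ratioP ^+ b.+1 =
    tP * (tP * geomP ^+ 2 * ratioP ^+ b.+1) + tP * geomP ^+ 2 * ratioP ^+ b
      + tP * (tP * geomP ^+ 2 * ratioP ^+ b).
  have e : ratioP = tP * ratioP + 1 + tP by ring: mult_geomP.
  rewrite [_ ^+ b.+1]exprS; move: (ratioP ^+ b) (ratioP) e => x y e.
  by rewrite {1}e; ring.
rewrite !raddfD /= !ev_multS IHm !IH -!polyCD -addrA; congr _%:P.
by have [] := ehrhart_shift b m%:R; rewrite natr1 => <- _; rewrite addrC subrK.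
Qed.

Lemma poly_eq_nat (R : idomainType) (f g : {poly R}) :
  injective (fun m => m%:R : R) -> (forall m, f.[m%:R] = g.[m%:R]) -> f = g.
Proof.
move=> inj e; apply/eqP; rewrite -subr_eq0; apply/eqP.
pose s := [seq m%:R : R | m <- iota 0 (size (f - g))].
apply: (@roots_geq_poly_eq0 _ _ s).
- by apply/allP => _ /mapP[m _ ->]; rewrite rootE !hornerE e subrr.
- by rewrite map_inj_uniq ?iota_uniq.
- by rewrite size_map size_iota.
Qed.

Lemma natr_polyQ m : m%:R = (m%:R)%:P :> {poly rat}.
Proof. by rewrite polyC_natr. Qed.

Lemma natr_polyQ_inj : injective (fun m => m%:R : {poly rat}).
Proof.
move=> m n /=; rewrite !natr_polyQ => /polyC_inj /eqP.
by rewrite Num.Theory.eqr_nat => /eqP.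
Qed.

(* y/2 stands for u, so that z = 1 - 2u becomes 1 - y. *)
Definition half_y : Qpxy := 2^-1 *: var_y.

Definition zeta : {poly rat} -> Qpxy := horner_alg half_y.
HB.instance Definition _ := GRing.LRMorphism.on zeta.

(* The outer variable is p and the inner one is u. *)
Definition eta : {poly {poly rat}} -> Qpxy := horner_eval var_p \o map_poly zeta.
HB.instance Definition _ := GRing.RMorphism.on eta.

(** Every generator of degree n contains (1 + y)^n x^n, the n-th power of this element. *)
Definition xvar : Qpxy := (1 + var_y) * var_x.

Definition zvar : {poly rat} := 1 - 'X - 'X.

Lemma zeta_zvar : zeta zvar = 1 - var_y.
Proof.
rewrite /zvar !rmorphB rmorph1 /= /zeta /= horner_algX /half_y -addrA -opprD.
by rewrite -scalerDl (_ : 2^-1 + 2^-1 = 1 :> rat) ?scale1r.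
Qed.

Lemma etaC q : eta q%:P = zeta q.
Proof. by rewrite /eta /= map_polyC /= /horner_eval hornerC. Qed.

Lemma etaX : eta 'X = var_p.
Proof. by rewrite /eta /= map_polyX /horner_eval hornerX. Qed.

Lemma etaZ (c : rat) G : eta (c%:P *: G) = c *: eta G.
Proof.
rewrite -mul_polyC rmorphM /= etaC -[c%:P]alg_polyC linearZ /=.
by rewrite rmorph1 mulr1 -scalerAl mul1r.
Qed.

Definition mono (n a i : nat) : Qpxy := var_p ^+ a * (1 - var_y) ^+ i * xvar ^+ n.

(* Reindexing of the degree n generators of [pol_span] by a = n - j and i = j - 2k. *)
Definition mono_set (n : nat) : set Qpxy :=
  [set f | exists a i, [/\ (1 <= a)%N, (a + i <= n)%N, ~~ odd (n - (a + i)) & f = mono n a i]].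

Definition ehrhart_p b : Qpxy := eta (map_poly polyC (ehrhart b)).

Lemma ehrhart_pSS b : ehrhart_p b.+2 =
  b.+3%:R^-1 *: ((var_p * ehrhart_p b.+1) *+ 2 + ehrhart_p b *+ b.+1).
Proof.
rewrite /ehrhart_p ehrhartSS map_polyZ etaZ; congr (_ *: _).
by rewrite !(rmorphD, rmorphMn, rmorphM) /= map_polyX etaX.
Qed.

Lemma mono_set_mulp n v : Qspan (mono_set n) v -> Qspan (mono_set n.+1) (var_p * xvar * v).
Proof.
elim/Qspan_ind => [|c f g IHf IHg|_ [a [i [a1 le od ->]]]].
- by rewrite mulr0; exact: Qspan0.
- by rewrite mulrDr -scalerAr; exact: Qspan_lin.
apply: Qspan_gen; exists a.+1, i; split=> //; rewrite /mono ?exprS; ring.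
Qed.

(** The recurrence keeps all exponents of p at least 1 and of the parity of b + 1. It has two steps,
    so two consecutive b are proved together. *)
Lemma ehrhart_p_span b n i : (b + 1 + i <= n)%N -> ~~ odd (n - (b + 1 + i)) ->
  Qspan (mono_set n) (ehrhart_p b * (1 - var_y) ^+ i * xvar ^+ n).
Proof.
move: b n i; suff : forall b, (forall n i, (b + 1 + i <= n)%N -> ~~ odd (n - (b + 1 + i)) ->
    Qspan (mono_set n) (ehrhart_p b * (1 - var_y) ^+ i * xvar ^+ n)) /\
  (forall n i, (b.+1 + 1 + i <= n)%N -> ~~ odd (n - (b.+1 + 1 + i)) ->
    Qspan (mono_set n) (ehrhart_p b.+1 * (1 - var_y) ^+ i * xvar ^+ n)).
  by move=> H b; case: (H b).
elim=> [|b [IH IH1]].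
  split=> n i le od; apply: Qspan_gen.
    by exists 1%N, i; split=> //; rewrite /ehrhart_p ehrhart0 map_polyX etaX.
  by exists 2%N, i; split=> //; rewrite /ehrhart_p ehrhart1 map_polyXn rmorphXn /= etaX.
split=> // n i le od; rewrite ehrhart_pSS.
(* One power of [xvar] is set aside for the factor [var_p], since [mono_set_mulp] raises n and a
   together. *)
case: n le od => [|n] le od; first by move: le; rewrite addn1.
have -> : b.+3%:R^-1 *: (var_p * ehrhart_p b.+1 *+ 2 + ehrhart_p b *+ b.+1) *
    (1 - var_y) ^+ i * xvar ^+ n.+1 =
  (b.+3%:R^-1 * 2) *: (var_p * xvar * (ehrhart_p b.+1 * (1 - var_y) ^+ i * xvar ^+ n)) +
  (b.+3%:R^-1 * b.+1%:R) *: (ehrhart_p b * (1 - var_y) ^+ i * xvar ^+ n.+1).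
  rewrite -!scalerA -scalerDr -!scalerAl; congr (_ *: _).
  by rewrite !scaler_nat exprS; ring.
apply: Qspan_lin; first by apply: mono_set_mulp; apply: IH1; lia.
rewrite -[X in Qspan _ X]addr0; apply: Qspan_lin; last exact: Qspan0.
by apply: IH; lia.
Qed.

(** G interpolates the sequence as a polynomial in p over Q[u], and its image involves only
    monomials allowed in degree n. *)
Definition representable (n : nat) (c : nat -> {poly rat}) : Prop :=
  exists G, (forall m, G.[m%:R] = c m) /\ Qspan (mono_set n) (eta G * xvar ^+ n).

Lemma representable_lin n (k : rat) c c' : representable n c -> representable n c' ->
  representable n (fun m => k *: c m + c' m).
Proof.
case=> G [gG sG] [G' [gG' sG']]; exists (k%:P *: G + G'); split=> [m|].
  by rewrite hornerD hornerZ gG gG' mul_polyC.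
by rewrite rmorphD /= etaZ mulrDl -scalerAl; exact: Qspan_lin.
Qed.

Lemma representable_eq n c c' : (forall m, c m = c' m) ->
  representable n c -> representable n c'.
Proof. by move=> e [G [gG sG]]; exists G; split=> // m; rewrite gG e. Qed.

Notation zP := (1 - 'X - 'X : {poly fps}).

Lemma ev_mulC1X m (f : {poly fps}) : ev m ((1 - 'X) * f) = (1 - 'X) * ev m f.
Proof. by rewrite !mulrBl !mul1r raddfB /= ev_mulX. Qed.

Lemma ev_mulz m (f : {poly fps}) : ev m (zP * f) = zvar * ev m f.
Proof. by rewrite mulrBl raddfB /= ev_mulC1X ev_mulX -mulrBl. Qed.

Lemma ev_mulzX i m (f : {poly fps}) : ev m (zP ^+ i * f) = zvar ^+ i * ev m f.
Proof. by elim: i => [|i IH]; rewrite ?mul1r // !exprS -!mulrA ev_mulz IH. Qed.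

(* [h] behaves like a polynomial in z and (1+t)/(1-t) of degree at most [n] whose
   terms have the parity of [n]. *)
Definition ratio_factor (n : nat) (h : {poly fps}) : Prop :=
  forall b i N, (n + b + i + 1 <= N)%N -> ~~ odd (N - (n + b + i + 1)) ->
  representable N (fun m => ev m (zP ^+ i * h * (tP * geomP ^+ 2 * ratioP ^+ b))).

Lemma ratio_factor1 : ratio_factor 0 1.
Proof.
move=> b i N le od.
exists (map_poly polyC (ehrhart b) * (zvar ^+ i)%:P); split=> [m|].
  rewrite mulr1 ev_mulzX ev_ehrhart hornerM hornerC mulrC; congr (_ * _).
  by rewrite natr_polyQ horner_map.
rewrite rmorphM /= etaC rmorphXn /= zeta_zvar; apply: ehrhart_p_span; lia.
Qed.

Lemma ratio_factor_lin n h h' : ratio_factor n h -> ratio_factor n h' ->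
  ratio_factor n (h + h') /\ ratio_factor n (h - h').
Proof.
move=> g g'; split=> b i N le od; move: (g b i N le od) (g' b i N le od);
  move: (tP * geomP ^+ 2 * ratioP ^+ b) (zP ^+ i) => x y r r'.
  apply: representable_eq (representable_lin 1 r r') => m.
  by rewrite scale1r mulrDr mulrDl raddfD.
apply: representable_eq (representable_lin (-1) r' r) => m.
by rewrite scaleN1r addrC mulrBr mulrBl raddfB.
Qed.

(** A factor s or z is absorbed by raising b or i, which is why [ratio_factor] quantifies over
    both. *)
Lemma ratio_factor_mulr n h : ratio_factor n h -> ratio_factor n.+1 (h * ratioP).
Proof.
move=> g b i N le od.
have e : (n.+1 + b + i + 1 = n + b.+1 + i + 1)%N by lia.
rewrite e in le od.
apply: representable_eq (g b.+1 i N le od) => m.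
by congr (ev _ _); rewrite [ratioP ^+ b.+1]exprS; ring.
Qed.

Lemma ratio_factor_z n h : ratio_factor n h -> ratio_factor n.+1 (h * zP).
Proof.
move=> g b i N le od.
have e : (n.+1 + b + i + 1 = n + b + i.+1 + 1)%N by lia.
rewrite e in le od.
apply: representable_eq (g b i.+1 N le od) => m.
by congr (ev _ _); rewrite [zP ^+ i.+1]exprS; ring.
Qed.

Lemma ratio_factor_add2 n h : ratio_factor n h -> ratio_factor n.+2 h.
Proof. by move=> g b i N le od; apply: g; lia. Qed.

Lemma ratio_factor_prod j c d :
  ratio_factor (2 * j + c + d) ((ratioP ^+ 2 - 1) ^+ j * (ratioP - zP) ^+ c * (ratioP + zP) ^+ d).
Proof.
elim: d => [|d IH]; last first.
  rewrite addnS [_ ^+ d.+1]exprSr mulrA mulrDr.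
  by case: (ratio_factor_lin (ratio_factor_mulr IH) (ratio_factor_z IH)).
rewrite addn0 mulr1; elim: c => [|c IH]; last first.
  rewrite addnS [_ ^+ c.+1]exprSr mulrA mulrBr.
  by case: (ratio_factor_lin (ratio_factor_mulr IH) (ratio_factor_z IH)).
rewrite addn0 mulr1; elim: j => [|j IH]; first exact: ratio_factor1.
rewrite mulnS [_ ^+ j.+1]exprSr mulrBr mulr1 {2}expr2 [_ ^+ j * _]mulrA.
exact: (ratio_factor_lin (ratio_factor_mulr (ratio_factor_mulr IH)) (ratio_factor_add2 IH)).2.
Qed.

(** Here A + B = 1, s^2 - 1 = 4t / (1 - t)^2, s - z = 2(u + (1 - u)t) / (1 - t) and s + z = 2(1 - u
    + ut) / (1 - t). *)
Lemma run_frac_factors j c d :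
  run_frac 'X (1 - 'X) j c d *+ 2 ^ (2 * j + c + d) =
  (ratioP ^+ 2 - 1) ^+ j * (ratioP - zP) ^+ c * (ratioP + zP) ^+ d * (tP * geomP ^+ 2).
Proof.
have -> : ratioP ^+ 2 - 1 = 2%:R * 2%:R * tP * geomP * geomP :> {poly fps}.
  by rewrite expr2; ring: mult_geomP.
have -> : ratioP - zP = 2%:R * ('X + (1 - 'X) * tP) * geomP by ring: mult_geomP.
have -> : ratioP + zP = 2%:R * (1 - 'X + 'X * tP) * geomP by ring: mult_geomP.
rewrite /run_frac [X in X ^+ (2 * j + 1)]addrC subrK expr1n mulr1 -[LHS]mulr_natr natrX.
rewrite mul2n -addnn !exprMn !exprD [tP ^+ j.+1]exprS.
set x := _ ^+ c; set y := _ ^+ d.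
by set u := 2%:R ^+ j; ring.
Qed.

Lemma wcount_class (p q : pword) m : size p = size q -> pkdes p = pkdes q ->
  wcount 'X (1 - 'X) m p = wcount 'X (1 - 'X) m q :> {poly rat}.
Proof.
move=> es e; have [ep ed] : pk p = pk q /\ des p = des q by case: e.
case: (posnP (size p)) => [p0|p0].
  have e0 : (p : seq nat) = [::] by apply: size0nil.
  by have -> : (q : seq nat) = [::]; [apply: size0nil; rewrite -es | rewrite e0].
have wp : (p : seq nat) != [::] by rewrite -size_eq0 -lt0n.
have wq : (q : seq nat) != [::] by rewrite -size_eq0 -es -lt0n.
have [c [d [eD eN <-]]] := gf_word ev_mulX ev_mulC1X (pw_uniq p) wp.
have [c' [d' [eD' eN' <-]]] := gf_word ev_mulX ev_mulC1X (pw_uniq q) wq.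
rewrite -pkE in eD eN *; rewrite -pkE in eD' eN' *; rewrite -desE in eD; rewrite -desE in eD'.
have cc : c = c' by apply: (@addnI (pk p)); rewrite -eD ed eD' ep.
rewrite -{}cc in eD' eN' *.
have <- : d = d'.
  by apply: (@addnI (2 * pk p + c)); apply: (@addIn 1); rewrite -eN es eN' ep.
by rewrite ep.
Qed.

(** The empty word is set apart because [mono_set 0] is empty. *)
Lemma exists_word_pol (p : pword) : exists G : {poly {poly rat}},
  (forall m, G.[m%:R] = wcount 'X (1 - 'X) m p) /\
  (if size p == 0%N then G = 1
   else Qspan (mono_set (size p)) (eta G * xvar ^+ size p)).
Proof.
case: eqP => [/size0nil ->|/eqP sz].
  by exists 1; split=> // m; rewrite wcount_nil hornerE.
have w0 : (p : seq nat) != [::] by rewrite -size_eq0.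
have [c [d [eD eN g]]] := gf_word ev_mulX ev_mulC1X (pw_uniq p) w0.
set n := (2 * pk_seq p + c + d)%N in eN.
have [G [gG sG]] : representable (size p) (wcount 'X (1 - 'X) ^~ p); last by exists G.
have le : (n + 0 + 0 + 1 <= size p)%N by rewrite eN !addn0.
have od : ~~ odd (size p - (n + 0 + 0 + 1)) by rewrite eN !addn0 subnn.
have r := @ratio_factor_prod (pk_seq p) c d 0 0 (size p) le od.
(* The zero sequence lets [representable_lin] act as scaling by 2^-n. *)
have r0 : representable (size p) (fun=> 0).
  exists 0; split=> [m|]; first by rewrite horner0.
  by rewrite rmorph0 mul0r; exact: Qspan0.
apply: representable_eq (representable_lin (2 ^ n)%:R^-1 r r0) => m.
rewrite expr0 mul1r expr0 mulr1 addr0 -run_frac_factors raddfMn /= g -/n.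
rewrite -scaler_nat scalerA mulVf ?scale1r //.
by rewrite Num.Theory.pnatr_eq0 expn_eq0.
Qed.

(** The choice is canonical: by [poly_eq_nat] the values at all natural numbers determine G. *)
Definition word_pol (p : pword) : {poly {poly rat}} := projT1 (cid (exists_word_pol p)).

Lemma word_polE p m : (word_pol p).[m%:R] = wcount 'X (1 - 'X) m p.
Proof. by rewrite /word_pol; case: cid => G /= []. Qed.

Definition pol_image (p : pword) : Qpxy := eta (word_pol p) * xvar ^+ size p.

Lemma pol_image_in (p : pword) : (0 < size p)%N -> Qspan (mono_set (size p)) (pol_image p).
Proof.
by rewrite /pol_image /word_pol => p0; case: cid => G /= [_]; rewrite eqn0Ngt p0.
Qed.

Lemma pol_image_nil : pol_image pw_nil = 1.
Proof.
rewrite /pol_image /word_pol; case: cid => G /= [_ ->].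
by rewrite rmorph1 mul1r.
Qed.

Lemma pol_image_class (p q : pword) :
  size p = size q -> pkdes p = pkdes q -> pol_image p = pol_image q.
Proof.
move=> es ep; have e : word_pol p = word_pol q.
  apply: poly_eq_nat natr_polyQ_inj _ => m.
  by rewrite !word_polE; exact: wcount_class.
by rewrite /pol_image e es.
Qed.

(** Polynomials in p are compared at p = m, where the claim is [wcount_shuffles]. *)
Lemma pol_image_mul p q : disj p q ->
  \sum_(u <- shuffles p q) pol_image u = pol_image p * pol_image q.
Proof.
move=> d; rewrite /pol_image mulrACA -exprD -rmorphM /=.
have -> : word_pol p * word_pol q = \sum_(u <- shuffles p q) word_pol u.
  apply: poly_eq_nat natr_polyQ_inj _ => m.
  rewrite hornerM horner_sum !word_polE -wcount_shuffles //.
  by apply: eq_bigr => u _; rewrite word_polE.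
rewrite rmorph_sum mulr_suml big_seq [RHS]big_seq.
by apply: eq_bigr => u /size_shuffle ->.
Qed.

(** * Reading off coefficients in Q[p,x,y] *)

Definition Qpux : Type := {poly {poly {poly rat}}}.
HB.instance Definition _ := GRing.ComNzRing.on Qpux.

Definition pux_const : rat -> Qpux := polyC \o polyC \o polyC.
HB.instance Definition _ := GRing.RMorphism.on pux_const.

(** The variables are x outermost, then p, then u; substituting 2u for y undoes [eta]. *)
Definition pux_var (i : 'I_3) : Qpux :=
  nth 0 [:: 'X%:P; 'X; ('X *+ 2)%:P%:P] i.

Definition to_pux : Qpxy -> Qpux := mpoly.mmap pux_const pux_var.

Fact to_pux_additive : zmod_morphism to_pux.
Proof. by move=> f g; exact: mpoly.mmapB. Qed.

HB.instance Definition _ :=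
  GRing.isZmodMorphism.Build Qpxy Qpux to_pux to_pux_additive.

Fact to_pux_monoid : monoid_morphism to_pux.
Proof. by have [fM f1] := mpoly.mmap_is_multiplicative pux_var pux_const. Qed.

HB.instance Definition _ :=
  GRing.isMonoidMorphism.Build Qpxy Qpux to_pux to_pux_monoid.

Lemma to_puxZ (c : rat) f : to_pux (c *: f) = c%:P%:P%:P * to_pux f.
Proof. exact: mpoly.mmapZ. Qed.

Lemma to_pux_vars : [/\ to_pux var_p = 'X%:P, to_pux var_x = 'X
  & to_pux var_y = ('X *+ 2)%:P%:P].
Proof.
by split; rewrite /to_pux [LHS]mpoly.mmapX mpoly.mmap1U.
Qed.

Lemma to_pux_zeta (q : {poly rat}) : to_pux (zeta q) = q%:P%:P.
Proof.
have [_ _ yE] := to_pux_vars.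
elim/poly_ind: q => [|q c IH]; first by rewrite !rmorph0.
rewrite !rmorphD !rmorphM /= IH; congr (_ * _ + _).
  rewrite /zeta /= horner_algX /half_y to_puxZ yE -!polyCM; congr (_%:P%:P).
  by rewrite mul_polyC -scalerMnr -scaler_nat scalerA mulfV ?scale1r.
by rewrite /zeta /= horner_algC to_puxZ rmorph1 mulr1.
Qed.

Lemma to_pux_eta G : to_pux (eta G) = G%:P.
Proof.
have [pE _ _] := to_pux_vars.
elim/poly_ind: G => [|G c IH]; first by rewrite !rmorph0.
by rewrite !rmorphD !rmorphM /= IH etaX pE etaC to_pux_zeta.
Qed.

Lemma to_pux_xvar : to_pux xvar = (1 + 'X *+ 2)%:P%:P * 'X.
Proof.
have [_ xE yE] := to_pux_vars.
by rewrite /xvar rmorphM rmorphD rmorph1 /= xE yE !polyCD !polyC1.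
Qed.

Lemma to_pux_pol_image p : to_pux (pol_image p) =
  (word_pol p * ((1 + 'X *+ 2) ^+ size p)%:P)%:P * 'X^(size p).
Proof.
by rewrite /pol_image rmorphM rmorphXn /= to_pux_eta to_pux_xvar exprMn mulrA polyCM -!polyC_exp.
Qed.

Definition pol_ev (n m : nat) (f : Qpxy) : {poly rat} := ((to_pux f)`_n).[m%:R].

Lemma pol_image_inj (a : {malg rat[st_class pkdes]}) :
  lext (fun k => pol_image (st_repr k)) a = 0 -> a = 0.
Proof.
apply: (@lext_injective _ _ (1 - 'X) (1 - 'X) (fun n => (1 + 'X *+ 2) ^+ n) pol_ev).
- exact: ev_mulC1X.
- by rewrite coefB coef1 coefX subr0.
- by move=> n; rewrite -horner_coef0 horner_exp hornerD hornerMn hornerX hornerC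
  mul0rn addr0 expr1n.
- move=> n m c f g; rewrite /pol_ev rmorphD /= to_puxZ coefD hornerD coefCM.
  by rewrite hornerM hornerC mul_polyC.
move=> n m p; rewrite /pol_ev to_pux_pol_image coefMXn coefC subn_eq0.
case: (ltngtP (size p) n) => [||<-]; rewrite ?horner0 //.
by rewrite hornerM hornerC word_polE.
Qed.

(** * Dimensions *)

Lemma Qspan_range (V : lmodType rat) d (e : 'I_d -> V) v : Qspan (range e) v ->
  exists c : 'I_d -> rat, v = \sum_(i < d) c i *: e i.
Proof.
elim/Qspan_ind => [|x _ _ [c ->] [c' ->]|_ [i _ <-]].
- by exists (fun=> 0); rewrite big1 // => i _; rewrite scale0r.
- exists (fun i => x * c i + c' i); rewrite scaler_sumr -big_split /=.
  by apply: eq_bigr => i _; rewrite scalerDl scalerA.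
exists (fun j => (j == i)%:R); rewrite (bigD1 i) //= eqxx scale1r big1 ?addr0 //.
by move=> j /negbTE ->; rewrite scale0r.
Qed.

(** Freeness of v makes the rows of its matrix over e independent, so this square matrix is
    invertible. *)
Lemma Qspan_free_exchange (V : lmodType rat) d (v e : 'I_d -> V) :
  (forall c : 'I_d -> rat, \sum_(i < d) c i *: v i = 0 -> forall i, c i = 0) ->
  (forall i, Qspan (range e) (v i)) -> forall i, Qspan (range v) (e i).
Proof.
move=> free sub i.
have [A vA] := choice (fun i => Qspan_range (sub i)).
pose M := \matrix_(i, j) A i j.
have Mu : M \in unitmx.
  rewrite -row_free_unit; apply/inj_row_free => w wM.
  apply/rowP => k; rewrite mxE; apply: (free (fun k => w 0 k)) => {k}.
  have -> : \sum_k w 0 k *: v k = \sum_k \sum_j (w 0 k * M k j) *: e j.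
    apply: eq_bigr => k _; rewrite vA scaler_sumr.
    by apply: eq_bigr => j _; rewrite scalerA mxE.
  rewrite exchange_big big1 //= => j _; rewrite -scaler_suml.
  have /rowP/(_ j) := wM; rewrite mxE => ->.
  by rewrite mxE scale0r.
have -> : e i = \sum_k (invmx M) i k *: v k.
  have -> : e i = \sum_j (invmx M *m M) i j *: e j.
    rewrite mulVmx // (bigD1 i) //= mxE eqxx scale1r big1 ?addr0 // => j ji.
    by rewrite mxE eq_sym (negbTE ji) scale0r.
  have -> : \sum_k (invmx M) i k *: v k = \sum_k \sum_j ((invmx M) i k * M k j) *: e j.
    apply: eq_bigr => k _; rewrite vA scaler_sumr.
    by apply: eq_bigr => j _; rewrite scalerA mxE.
  by rewrite exchange_big; apply: eq_bigr => j _; rewrite -scaler_suml mxE.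
by apply: Qspan_sum => k; apply: Qspan_gen; exists k.
Qed.

(* A pair (a, k) encodes (pk, des) = (k, a - k), and also the generator of
   [pol_span] with j = a: the condition is a < n and 2k <= a in both cases. *)
Definition pd_indices (n : nat) : seq (nat * nat) :=
  [seq (a, k) | a <- iota 0 n, k <- iota 0 a./2.+1].

Lemma size_pd_indices n : size (pd_indices n) = ((n + 1) ^ 2 %/ 4)%N.
Proof.
elim: n => [|n IH] //.
have -> : pd_indices n.+1 = pd_indices n ++ [seq (n, k) | k <- iota 0 n./2.+1].
  by rewrite /pd_indices -addn1 iotaD map_cat flatten_cat /= cats0.
rewrite size_cat IH size_map size_iota.
by have := odd_double_half n; case: (odd n); nia.
Qed.

Lemma mem_pd_indices n a k : ((a, k) \in pd_indices n) = (a < n)%N && (2 * k <= a)%N.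
Proof.
apply/allpairsPdep/andP => [[a' [k' []]]|[an ka]].
  by rewrite !mem_iota !add0n /= => an ka [-> ->]; split=> //; lia.
by exists a, k; rewrite !mem_iota /=; split=> //; lia.
Qed.

Lemma pd_indices_uniq n : uniq (pd_indices n).
Proof.
apply: allpairs_uniq_dep => [|a _|]; rewrite ?iota_uniq //.
by move=> [a k] [a' k'] _ _ /= [-> ->].
Qed.

(** Membership is assumed under the existential so that [pd_word] is total. *)
Lemma exists_pd_word n x : exists p : pword, x \in pd_indices n ->
  [/\ size p = n, pk p = x.2 & des p = (x.1 - x.2)%N].
Proof.
case: x => a k; have [p [sp pp dp]] := exists_pword k (a - 2 * k) (n.-1 - a).
exists p; rewrite mem_pd_indices /= => /andP[an ka]; rewrite sp pp dp.
by split=> //; lia.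
Qed.

Definition pd_word n x : pword := projT1 (cid (exists_pd_word n x)).

Lemma pd_wordP n x : x \in pd_indices n ->
  [/\ size (pd_word n x) = n, pk (pd_word n x) = x.2
    & des (pd_word n x) = (x.1 - x.2)%N].
Proof. by rewrite /pd_word; case: cid. Qed.

Definition pd_index n (i : 'I_(size (pd_indices n))) : nat * nat :=
  nth (0, 0)%N (pd_indices n) i.

Lemma pd_indexP n (i : 'I_(size (pd_indices n))) : pd_index i \in pd_indices n.
Proof. exact: mem_nth. Qed.

Lemma exists_pd_index n x : x \in pd_indices n -> exists i, @pd_index n i = x.
Proof.
move=> xn; have lt : (index x (pd_indices n) < size (pd_indices n))%N by rewrite index_mem.
by exists (Ordinal lt); rewrite /pd_index /= nth_index.
Qed.

Lemma pd_classes_free n (c : 'I_(size (pd_indices n)) -> rat) :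
  \sum_i c i *: << st_pi pkdes (pd_word n (pd_index i)) >> = 0 :> {malg rat[st_class pkdes]} ->
  forall i, c i = 0.
Proof.
move=> c0 i; pose k0 := st_pi pkdes (pd_word n (pd_index i)).
have coefE : \sum_j c j * (st_pi pkdes (pd_word n (pd_index j)) == k0)%:R = 0.
  have := congr1 (mcoeff k0) c0; rewrite raddf_sum mcoeff0 => e; rewrite -[RHS]e.
  by apply: eq_bigr => j _; rewrite /= mcoeffZ mcoeffU.
move: coefE; rewrite (bigD1 i) //= /k0 eqxx mulr1 big1 ?addr0 // => j ji.
case: (st_piP pkdes) => [[_ [ep ed]]|_]; last by rewrite mulr0.
have [_ pi di] := pd_wordP (pd_indexP i); have [_ pj dj] := pd_wordP (pd_indexP j).
case/eqP: ji; apply/ord_inj/eqP.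
rewrite -(nth_uniq (0, 0)%N (ltn_ord j) (ltn_ord i) (pd_indices_uniq n)).
have := pd_indexP i; have := pd_indexP j; rewrite -/(pd_index j) -/(pd_index i).
move: pi di pj dj ep ed; case: (pd_index i) => a k; case: (pd_index j) => a' k' /=.
rewrite !mem_pd_indices => pi di pj dj ep ed le le'.
by apply/eqP; congr pair; lia.
Qed.

Lemma exists_pd_index_word (p : pword) : (0 < size p)%N ->
  exists i, st_pi pkdes (pd_word (size p) (@pd_index (size p) i)) = st_pi pkdes p.
Proof.
move=> p0; have bnd := des_pk_bounds p0.
have xin : (pk p + des p, pk p)%N \in pd_indices (size p).
  by rewrite mem_pd_indices; lia.
have [i ei] := exists_pd_index xin; exists i; rewrite ei.
have [s1 s2 s3] := pd_wordP xin; apply/eqP/(st_piP pkdes); split=> //=.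
by rewrite s2 s3 /= addKn.
Qed.

Lemma homogeneous_dim (h : shuffle_compatible pkdes) n : (1 <= n)%N ->
  has_dim (homogeneous h n) ((n + 1) ^ 2 %/ 4)%N.
Proof.
move=> n1; rewrite -size_pd_indices.
exists (fun i => cls h (pd_word n (pd_index i))); split; first exact: pd_classes_free.
apply/seteqP; split; apply: Qspan_sub.
  move=> _ [i _ <-].
  by apply: Qspan_gen; exists (pd_word n (pd_index i)) => //=; case: (pd_wordP (pd_indexP i)).
move=> _ [p sp <-]; rewrite -[n]sp in n1 *; have [i ei] := exists_pd_index_word n1.
by apply: Qspan_gen; exists i; rewrite // /cls ei.
Qed.

Lemma pol_genE n j k : var_p ^+ (n - j) * (1 + var_y) ^+ n
    * (1 - var_y) ^+ (j - 2 * k) * var_x ^+ n = mono n (n - j) (j - 2 * k).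
Proof. by rewrite /mono /xvar exprMn; ring. Qed.

Lemma mono_setE n f : mono_set n f -> exists i : 'I_(size (pd_indices n)),
  f = mono n (n - (pd_index i).1) ((pd_index i).1 - 2 * (pd_index i).2).
Proof.
case=> a [i [a1 le od ->]].
have := odd_double_half (n - (a + i)); rewrite (negbTE od) add0n => e.
(* This solves a = n - j and i = j - 2k for j and k. *)
have xin : (n - a, (n - (a + i))./2)%N \in pd_indices n by rewrite mem_pd_indices; lia.
have [x ex] := exists_pd_index xin; exists x; rewrite ex /=; congr (mono n _ _); lia.
Qed.

(** For the converse inclusion, the images of the classes of size n are free by injectivity and lie
    in the span of equally many monomials, so the exchange lemma recovers each monomial. *)
Lemma pol_image_span : Qspan (range pol_image) = pol_span.
Proof.
apply/seteqP; split; apply: Qspan_sub.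
  move=> _ [p _ <-]; case: (posnP (size p)) => [p0|p0].
    have -> : pol_image p = 1.
      by rewrite -pol_image_nil; congr pol_image; apply: val_inj; apply: size0nil.
    by apply: Qspan_gen; left.
  apply: (Qspan_sub _ (pol_image_in p0)) => f /mono_setE[i ->]; apply: Qspan_gen.
  right; exists (size p), (pd_index i).1, (pd_index i).2; rewrite -pol_genE.
  have := pd_indexP i; case: (pd_index i) => a k; rewrite mem_pd_indices /=.
  by split=> //; lia.
move=> f [->|[n [j [k [n1 jn kj ->]]]]].
  by apply: Qspan_gen; exists pw_nil; rewrite ?pol_image_nil.
have xin : (j, k) \in pd_indices n by rewrite mem_pd_indices; lia.
have [i ei] := exists_pd_index xin.
pose e (i : 'I_(size (pd_indices n))) :=
  mono n (n - (pd_index i).1) ((pd_index i).1 - 2 * (pd_index i).2).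
pose v (i : 'I_(size (pd_indices n))) := pol_image (pd_word n (pd_index i)).
have -> : var_p ^+ (n - j) * (1 + var_y) ^+ n * (1 - var_y) ^+ (j - 2 * k) * var_x ^+ n = e i.
  by rewrite pol_genE /e ei.
suff : Qspan (range v) (e i).
  apply: Qspan_sub => _ [l _ <-]; apply: Qspan_gen; exists (pd_word n (pd_index l)) => //.
apply: Qspan_free_exchange => [c c0|l].
  apply: pd_classes_free; apply: pol_image_inj; rewrite linear_sum -[RHS]c0.
  apply: eq_bigr => l _.
  have lextE : lext (fun k => pol_image (st_repr k))
      << st_pi pkdes (pd_word n (pd_index l)) >> = v l.
    by apply: etrans (lextU _ _) _; exact: (F_reprE pol_image_class).
  by rewrite linearZ /= lextE.
have [sl _ _] := pd_wordP (pd_indexP l).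
have l0 : (0 < size (pd_word n (pd_index l)))%N by rewrite sl.
have := pol_image_in l0; rewrite -/(v l) sl.
by apply: Qspan_sub => g /mono_setE[x ->]; apply: Qspan_gen; exists x.
Qed.

Theorem theorem5p9 :
  shuffle_compatible pkdes /\
  forall h : shuffle_compatible pkdes,
    [/\ subalgebra pd_span /\
          (exists phi : {lrmorphism shuffle_alg h -> Qtxy},
             (forall p : pword, phi (cls h p) = pd_image p) /\
             set_bij [set: shuffle_alg h] pd_span phi),
        subalgebra pol_span /\
          (exists psi : {lrmorphism shuffle_alg h -> Qpxy},
             set_bij [set: shuffle_alg h] pol_span psi)
      & forall n : nat, (1 <= n)%N ->
          has_dim (homogeneous h n) ((n + 1) ^ 2 %/ 4)%N].
Proof.
split; first exact: (pkdes_shuffle_compatible pd_image_class pd_image_mul pd_image_inj).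
move=> h; split; last exact: homogeneous_dim.
  exact: (class_map_iso pd_image_class pd_image_nil pd_image_mul h pd_image_inj pd_image_span).
have [sub [psi [_ bij]]] :=
  class_map_iso pol_image_class pol_image_nil pol_image_mul h pol_image_inj pol_image_span.
by split=> //; exists psi.
Qed.
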